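(* Let $\mathcal F$ be a good class. Let $O\subseteq\mathbb R^N$ be open and let $G,H:O\to\mathbb R$ be in $\mathcal F$ with $G<H$ on $O$. Put $U=\{(x,y)\in\mathbb R^{N+1}: x\in O,\ G(x)<y<H(x)\}$. Assume $F:U\to\mathbb R$ is in $\mathcal F$ and that there is a function $K:O\to\mathbb R$ in $\mathcal F$ with $|F(x,y)|\le K(x)$ for all $(x,y)\in U$. Then $I(x)=\int_{G(x)}^{H(x)}F(x,y)\,dy$ is a function $O\to\mathbb R$ in $\mathcal F$.
   Context: A class $\mathcal F$ of functions $\mathbb N^n\to\mathbb N$ ($n$ varying) is good if it contains all constant functions, projections, the successor function and $x\dot- y=\max\{0,x-y\}$, and is closed under composition and bounded summation $f(\bar x,y)=\sum_{i=0}^y g(\bar x,i)$. Functions involving $\mathbb Q$ are coded by natural numbers ($z\in\mathbb Z$ by $(\max(z,0),-\min(0,z))$, $r\in\mathbb Q$ by $(z,n)$ with $r=z/n$, $n>0$, $\gcd(z,n)=1$) and are in $\mathcal F$ if the coded function is componentwise in $\mathcal F$. On $\mathbb R^N$ use the maximum norm. For open $O\subseteq\mathbb R^N$ and integer $e\ge1$ let $O_e=\{x\in O:|x|\le e,\ \mathrm{dist}(x,\mathbb R^N\setminus O)\ge1/e\}$. A function $F:O\to\mathbb R$ is in $\mathcal F$ if there are $\mathcal F$-functions $d:\mathbb N\to\mathbb N$ and $f:\mathbb Q^N\times\mathbb N\to\mathbb Q$ such that for all integers $e\ge1$, all $a\in\mathbb Q^N$ and all $x\in O_e$: $|x-a|<1/d(e)$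 implies $|F(x)-f(a,e)|<1/e$. *)

(* Defs.v *)
From HB Require Import structures.
From mathcomp Require Import all_boot all_order all_algebra.
From mathcomp Require Import all_classical all_reals all_analysis.

Set Implicit Arguments.
Unset Strict Implicit.
Unset Printing Implicit Defensive.

Import Order.TTheory GRing.Theory Num.Theory.
Import numFieldNormedType.Exports.

Local Open Scope classical_set_scope.
Local Open Scope ring_scope.

Definition fun_class := forall n : nat, set (n.-tuple nat -> nat).

Record good (FF : fun_class) : Prop := Good {
  good_const : forall n c : nat, FF n (fun _ => c);
  good_proj : forall (n : nat) (i : 'I_n), FF n (fun t => tnth t i);
  good_succ : FF 1 (fun t => (tnth t ord0).+1);
  good_subn : FF 2 (fun t => (tnth t ord0 - tnth t ord_max)%N);
  good_comp : forall (m n : nat) (g : m.-tuple nat -> nat)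
      (h : 'I_m -> n.-tuple nat -> nat),
    FF m g -> (forall i, FF n (h i)) ->
    FF n (fun t => g [tuple h i t | i < m]);
  good_bsum : forall (n : nat) (f g : n.+1.-tuple nat -> nat),
    FF n.+1 g ->
    (forall (x : n.-tuple nat) (y : nat),
       f [tuple of rcons x y] = (\sum_(i < y.+1) g [tuple of rcons x i])%N) ->
    FF n.+1 f }.

(* A rational r = z/n in lowest terms, n > 0, has the code
   (max(z,0), -min(0,z), n). *)
Definition code_pos (r : rat) : nat := absz (Num.max (numq r) 0).
Definition code_neg (r : rat) : nat := absz (- Num.min 0 (numq r)).
Definition code_den (r : rat) : nat := absz (denq r).

Definition code_args (N : nat) (a : 'rV[rat]_N) (e : nat) :
    (N * 3).+1.-tuple nat :=
  [tuple of rcons (allpairs_tuple (fun r c => c r) [tuple a ord0 i | i < N]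
                     [tuple code_pos; code_neg; code_den]) e].

Definition nat_fun_in (FF : fun_class) (d : nat -> nat) : Prop :=
  FF 1 (fun t => d (tnth t ord0)).

(* The coded function is only specified on tuples of codes; being in the class
   means being there the restriction of a member of the class.  (The set of
   codes is itself decidable in any good class, so extending by 0 outside it
   gives the same notion.) *)
Definition coded_in (FF : fun_class) (N : nat)
    (u : 'rV[rat]_N -> nat -> nat) : Prop :=
  exists2 g : (N * 3).+1.-tuple nat -> nat, FF _ g &
    forall a e, g (code_args a e) = u a e.

Definition rat_fun_in (FF : fun_class) (N : nat)
    (f : 'rV[rat]_N -> nat -> rat) : Prop :=
  [/\ coded_in FF (fun a e => code_pos (f a e)),
      coded_in FF (fun a e => code_neg (f a e)) &
      coded_in FF (fun a e => code_den (f a e))].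

(* The norm on row vectors is the maximum norm, and edist_inf is the distance
   to a set, with value +oo for the empty set (the case where O is everything). *)
Definition exhaust (R : realType) (N : nat) (O : set 'rV[R]_N) (e : nat) :
    set 'rV[R]_N :=
  [set x | [/\ O x, `|x| <= e%:R & ((e%:R^-1)%:E <= edist_inf (~` O) x)%E]].

(* Functions O -> R are total functions of which only the values on O matter.
   Positivity of d e is implicit in the bound 1 / d(e); it must be required
   since 0^-1 = 0 here, which would make the approximation condition void. *)
Definition real_fun_in (FF : fun_class) (R : realType) (N : nat)
    (O : set 'rV[R]_N) (F : 'rV[R]_N -> R) : Prop :=
  exists (d : nat -> nat) (f : 'rV[rat]_N -> nat -> rat),
    [/\ nat_fun_in FF d, rat_fun_in FF f,
        forall e, (0 < e)%N -> (0 < d e)%N &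
        forall (e : nat) (a : 'rV[rat]_N) (x : 'rV[R]_N),
          (0 < e)%N -> exhaust O e x ->
          `|x - map_mx ratr a| < (d e)%:R^-1 ->
          `|F x - ratr (f a e)| < e%:R^-1].

Definition snoc (R : realType) (N : nat) (x : 'rV[R]_N) (y : R) : 'rV[R]_(N + 1) :=
  row_mx x (const_mx y).

Definition between (R : realType) (N : nat) (O : set 'rV[R]_N)
    (G H : 'rV[R]_N -> R) : set 'rV[R]_(N + 1) :=
  [set z | exists x y, [/\ z = snoc x y, O x & G x < y < H x]].

(* Main.v *)
Require Import Defs.
From HB Require Import structures.
From mathcomp Require Import all_boot all_order all_algebra.
From mathcomp Require Import all_classical all_reals all_analysis.
From mathcomp Require Import measurable_realfun zify ring lra.
Import Order.TTheory GRing.Theory Num.Theory.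
Import numFieldNormedType.Exports.
Local Open Scope classical_set_scope.
Local Open Scope ring_scope.

(** A good class contains the usual polynomially bounded arithmetic (products,
quotients, gcd, hence reduced fractions), but it need not contain exponentials:
a long sum of fractions may have no common denominator computable in the class,
so the values summed below are first truncated to multiples of a fixed [1/L].

A function of the class on [O] is bounded on [O_e] by a function [B e] of the
class, namely the sum of its approximations over a rational grid of [[-e, e]^N].
Take [B] to bound [G], [H] and [K].  For [x] in [O_e], a rational point [a] close
to [x] and a large precision [m], the numbers [fG a m], [fH a m] approximate
[G], [H] on a whole neighbourhood of [x]; hence [(x, y)] is well inside [U] as
soon as [fG a m + 2/m <= y <= fH a m - 2/m].  The Riemann sum of the truncated
approximations of [F] over the cells of a fine rational mesh satisfying this
test is in the class.  On these cells the integrand is well approximated, and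
the rest of [(G x, H x)] has length [O(1/m)], where [|F| <= B e]. *)

Set Implicit Arguments.
Unset Strict Implicit.
Unset Printing Implicit Defensive.

(** * Arithmetic in a good class *)

(** A number becomes a count of truth values: this is how quantities found by search turn into
    bounded sums, the only recursion a good class offers. *)
Lemma sum_ltn_minn (x q : nat) : (\sum_(i < x) (i < q)%N = minn x q)%N.
Proof.
elim: x => [|x IH]; first by rewrite big_ord0 min0n.
by rewrite big_ord_recr /= IH; case: (ltnP x q) => ?; lia.
Qed.

(** The quotient counts the positive multiples of [y] up to [x]. For [y = 0] every term of the sum
    is 1 while [x %/ 0] is 0, hence the first factor. *)
Lemma divn_sum (x y : nat) :
  (x %/ y = (0 < y)%N * \sum_(i < x) (i.+1 * y <= x)%N)%N.
Proof.
case: (posnP y) => [->|y0]; first by rewrite divn0 mul0n.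
rewrite mul1n -[LHS]/((x %/ y)%N) -(minn_idPr (leq_div x y)) -sum_ltn_minn.
by apply: eq_bigr => i _; rewrite leq_divRL.
Qed.

(** The gcd counts the [i] below it, and [i] is below it exactly when some common divisor [j.+1]
    exceeds [i]; the inner sum, tested for positivity, acts as an existential quantifier. *)
Lemma gcdn_sum (p q : nat) : (0 < q)%N ->
  (gcdn p q = \sum_(i < q)
     (0 < \sum_(j < q) (i <= j) * ((j.+1 %| p) * (j.+1 %| q)))%N)%N.
Proof.
move=> q0; have g0 : (0 < gcdn p q)%N by rewrite gcdn_gt0 q0 orbT.
have gq : (gcdn p q <= q)%N by rewrite dvdn_leq // dvdn_gcdr.
rewrite -{1}(minn_idPr gq) -sum_ltn_minn; apply: eq_bigr => i _.
congr (nat_of_bool _); rewrite [RHS]lt0n sum_nat_eq0.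
apply/idP/forallPn => [ig|[j]].
  have gq' : ((gcdn p q).-1 < q)%N by rewrite prednK.
  exists (Ordinal gq') => /=; rewrite prednK // dvdn_gcdl dvdn_gcdr.
  by rewrite -ltnS prednK // ig.
rewrite /= !muln_eq0 !eqb0 !negb_or !negbK => /and3P[ij jp jq].
by rewrite (leq_ltn_trans ij) // dvdn_leq // dvdn_gcd jp.
Qed.

Lemma code_frac_nat (p n : nat) (r : rat) : (0 < n)%N -> r = p%:R / n%:R ->
  [/\ code_pos r = (p %/ gcdn p n)%N, code_neg r = 0%N &
      code_den r = (n %/ gcdn p n)%N].
Proof.
move=> n0 {r}->; set g := gcdn p n.
have g0 : (0 < g)%N by rewrite gcdn_gt0 n0 orbT.
have pE : p = ((p %/ g) * g)%N by rewrite divnK // dvdn_gcdl.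
have nE : n = ((n %/ g) * g)%N by rewrite divnK // dvdn_gcdr.
have n'0 : (0 < n %/ g)%N by rewrite divn_gt0 // dvdn_leq // dvdn_gcdr.
have cop : coprime (p %/ g) (n %/ g).
  rewrite /coprime -(eqn_pmul2r g0) mul1n; apply/eqP.
  by rewrite muln_gcdl -pE -nE.
have -> : p%:R / n%:R = (Posz (p %/ g))%:~R / (Posz (n %/ g))%:~R :> rat.
  rewrite {1}pE {1}nE !natrM -mulf_div divff ?mulr1 //.
  by rewrite pnatr_eq0 -lt0n.
set r : rat := _ / _.
have num : numq r = (p %/ g)%N.
  by rewrite coprimeq_num // gtr0_sg ?mul1r // ltz_nat.
have den : denq r = (n %/ g)%N.
  by rewrite coprimeq_den //; case: eqP => // -[] /eqP; rewrite -leqn0 leqNgt n'0.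
rewrite /code_pos /code_neg /code_den num den; split => //.
by rewrite min_l.
Qed.

Lemma code_opp (r : rat) :
  [/\ code_pos (- r) = code_neg r, code_neg (- r) = code_pos r &
      code_den (- r) = code_den r].
Proof.
rewrite /code_pos /code_neg /code_den numqN denqN; split => //.
  by rewrite oppr_min oppr0 maxC.
by rewrite oppr_min opprK oppr0 maxC.
Qed.

(** One of the truncated differences [p - q] and [q - p] vanishes and their sum is the absolute
    value, so the reduced code needs no case distinction on the sign. *)
Lemma code_frac (p q n : nat) (r : rat) :
  (0 < n)%N -> r = (p%:R - q%:R) / n%:R ->
  [/\ code_pos r = ((p - q) %/ gcdn (p - q) n)%N,
      code_neg r = ((q - p) %/ gcdn (q - p) n)%N &
      code_den r = (n %/ gcdn ((p - q) + (q - p)) n)%N].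
Proof.
move=> n0 rE.
have [qp|/ltnW pq] := leqP q p.
  have [|-> -> ->] := @code_frac_nat (p - q) n r n0; first by rewrite rE natrB.
  by rewrite (eqP (qp : (q - p == 0)%N)) addn0 div0n.
have [<- <- <-] := code_opp r.
have [|-> -> ->] := @code_frac_nat (q - p) n (- r) n0.
  by rewrite rE natrB // -mulNr opprB.
by rewrite (eqP (pq : (p - q == 0)%N)) add0n div0n.
Qed.

Lemma code_den_gt0 (r : rat) : (0 < code_den r)%N.
Proof. by rewrite /code_den absz_gt0 denq_neq0. Qed.

Lemma rat_codeE (r : rat) :
  r = ((code_pos r)%:R - (code_neg r)%:R) / (code_den r)%:R.
Proof.
rewrite -{1}(divq_num_den r); congr (_ / _); last first.
  by rewrite /code_den -{1}(absz_denq r).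
rewrite /code_pos /code_neg.
have [z0|z0] := leP 0 (numq r).
  by rewrite oppr0 subr0 -{1}(gez0_abs z0).
rewrite sub0r -{1}(opprK (numq r)).
by rewrite -{1}(gez0_abs (_ : 0 <= - numq r)) ?oppr_ge0 ?ltW // rmorphN.
Qed.

(** The denominator is at least 1, so dropping it leaves a natural number bound that is read off the
    code. *)
Lemma norm_le_code (r : rat) : `|r| <= (code_pos r + code_neg r)%N%:R.
Proof.
rewrite {1}(rat_codeE r) normrM normfV !normr_nat natrD.
have d1 : 1 <= (code_den r)%:R :> rat by rewrite ler1n code_den_gt0.
rewrite ler_pdivrMr ?(lt_le_trans ltr01) //.
apply: (@le_trans _ _ ((code_pos r)%:R + (code_neg r)%:R)).
  by rewrite (le_trans (ler_normB _ _)) // !normr_nat.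
by rewrite ler_peMr // addr_ge0.
Qed.

(* [phi] is a function of the class in the natural numbers by which [c] codes
   its argument; outside the range of [c] nothing is required. *)
Definition definable (FF : fun_class) {T : Type} {n : nat}
    (c : T -> n.-tuple nat) (phi : T -> nat) : Prop :=
  exists2 g : n.-tuple nat -> nat, FF n g & forall t, phi t = g (c t).

Definition definable_rat (FF : fun_class) {T : Type} {n : nat}
    (c : T -> n.-tuple nat) (r : T -> rat) : Prop :=
  [/\ definable FF c (fun t => code_pos (r t)),
      definable FF c (fun t => code_neg (r t)) &
      definable FF c (fun t => code_den (r t))].

(** The additional number comes last because [good_bsum] sums over the last argument. *)
Definition extend_code {T : Type} {n : nat} (c : T -> n.-tuple nat)
    (p : T * nat) : n.+1.-tuple nat :=
  [tuple of rcons (c p.1) p.2].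

Lemma tnth_rcons_max (n : nat) (t : n.-tuple nat) (y : nat) :
  tnth [tuple of rcons t y] ord_max = y.
Proof. by rewrite (tnth_nth 0%N) /= nth_rcons size_tuple ltnn eqxx. Qed.

Lemma tnth_rcons_widen (n : nat) (t : n.-tuple nat) (y : nat) (i : 'I_n) :
  tnth [tuple of rcons t y] (widen_ord (leqnSn n) i) = tnth t i.
Proof. by rewrite !(tnth_nth 0%N) /= nth_rcons size_tuple ltn_ord. Qed.

Lemma ord_max_or_widen (n : nat) (i : 'I_n.+1) :
  i = ord_max \/ exists j, i = widen_ord (leqnSn n) j.
Proof.
have [lt|ge] := ltnP i n; [right|left].
  by exists (Ordinal lt); apply: val_inj.
by apply: val_inj => /=; have := ltn_ord i; lia.
Qed.

(** * Closure properties of a good class *)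

Section Definability.
Variables (FF : fun_class) (hFF : good FF).

Section Code.
Variables (T : Type) (n : nat) (c : T -> n.-tuple nat).
Local Notation D := (definable FF c).

Lemma eq_definable (phi psi : T -> nat) : phi =1 psi -> D phi -> D psi.
Proof. by move=> e [g Fg h]; exists g => // t; rewrite -e h. Qed.

Lemma definable_const (k : nat) : D (fun=> k).
Proof. by exists (fun=> k) => //; exact: good_const. Qed.

Lemma definable_tnth (i : 'I_n) : D (fun t => tnth (c t) i).
Proof. by exists (fun t => tnth t i) => //; exact: good_proj. Qed.

(** Closure under composition for arbitrary codings: the functions substituted are the entries of
    the code of [s t]. *)
Lemma definable_subst (T' : Type) (m : nat) (c' : T' -> m.-tuple nat)
    (phi : T' -> nat) (s : T -> T') :
  definable FF c' phi -> (forall i, D (fun t => tnth (c' (s t)) i)) ->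
  D (fun t => phi (s t)).
Proof.
move=> [g Fg hg] hs.
have {hs}/choice[h hh] : forall i, exists k : n.-tuple nat -> nat,
    @FF n k /\ forall t, tnth (c' (s t)) i = k (c t).
  by move=> i; have [k] := hs i; exists k.
exists (fun t => g [tuple h i t | i < m]).
  by apply: (good_comp hFF Fg) => i; have [] := hh i.
move=> t; rewrite hg; congr g; apply: eq_from_tnth => i.
by rewrite tnth_mktuple; have [_ ->] := hh i.
Qed.

Lemma definable_nat_fun (d : nat -> nat) (phi : T -> nat) :
  nat_fun_in FF d -> D phi -> D (fun t => d (phi t)).
Proof.
move=> Fd Dphi; apply: (@definable_subst nat 1 (fun x => [tuple x]) d phi).
  by exists (fun t => d (tnth t ord0)).
by move=> i; apply: eq_definable Dphi => t; rewrite (tnth_nth 0%N) ord1.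
Qed.

Lemma definable_succ (phi : T -> nat) : D phi -> D (fun t => (phi t).+1).
Proof. exact: definable_nat_fun (good_succ hFF). Qed.

Lemma definable_subn (phi psi : T -> nat) :
  D phi -> D psi -> D (fun t => (phi t - psi t)%N).
Proof.
move=> Dphi Dpsi; pose s t := (phi t, psi t).
apply: (@definable_subst (nat * nat)%type 2 (fun p => [tuple p.1; p.2])
  (fun p => p.1 - p.2)%N s).
  by exists (fun t => tnth t ord0 - tnth t ord_max)%N; first exact: good_subn hFF.
move=> i; case: (ord_max_or_widen i) => [->|[j ->]].
  by apply: eq_definable Dpsi => t; rewrite (tnth_nth 0%N).
by apply: eq_definable Dphi => t; rewrite (tnth_nth 0%N) ord1.
Qed.

Lemma definable_weaken (phi : T -> nat) :
  D phi -> definable FF (extend_code c) (fun p => phi p.1).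
Proof.
move=> [g Fg hg].
exists (fun t => g [tuple tnth t (widen_ord (leqnSn n) i) | i < n]).
  by apply: (good_comp hFF) => // i; exact: good_proj.
move=> p; rewrite hg; congr g; apply: eq_from_tnth => i.
by rewrite tnth_mktuple tnth_rcons_widen.
Qed.

Lemma definable_last : definable FF (extend_code c) snd.
Proof.
exists (fun t => tnth t ord_max); first exact: good_proj.
by move=> p; rewrite tnth_rcons_max.
Qed.

Lemma definable_bind (psi : T * nat -> nat) (b : T -> nat) :
  definable FF (extend_code c) psi -> D b -> D (fun t => psi (t, b t)).
Proof.
move=> Dpsi Db; pose s t := (t, b t).
apply: (@definable_subst (T * nat)%type n.+1 (extend_code c) psi s) => // i.
case: (ord_max_or_widen i) => [->|[j ->]].
  by apply: eq_definable Db => t; rewrite tnth_rcons_max.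
by apply: eq_definable (definable_tnth j) => t; rewrite tnth_rcons_widen.
Qed.

Lemma definable_sumS (b : T -> nat) (G : T -> nat -> nat) :
  definable FF (extend_code c) (fun p => G p.1 p.2) -> D b ->
  D (fun t => \sum_(i < (b t).+1) G t i)%N.
Proof.
move=> [g Fg hg] Db.
apply: (@definable_bind (fun p => \sum_(i < p.2.+1) G p.1 i)%N) => //.
(* The last entry of the tuple holds the bound of the sum; it is overwritten by the summation
   index. *)
pose upd (t : n.+1.-tuple nat) (i : nat) : n.+1.-tuple nat :=
  [tuple if (j < n)%N then tnth t j else i | j < n.+1].
have updE (x : n.-tuple nat) (y i : nat) :
    upd [tuple of rcons x y] i = [tuple of rcons x i].
  apply: eq_from_tnth => j; rewrite tnth_mktuple.
  case: (ord_max_or_widen j) => [->|[k ->]].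
    by rewrite /= ltnn tnth_rcons_max.
  by rewrite /= ltn_ord !tnth_rcons_widen.
exists (fun t => \sum_(i < (tnth t ord_max).+1) g (upd t i))%N.
  apply: (@good_bsum _ hFF _ _ g) => // x y; rewrite tnth_rcons_max.
  by apply: eq_bigr => i _; rewrite updE.
move=> [t y] /=; rewrite tnth_rcons_max; apply: eq_bigr => i _.
by rewrite /extend_code /= updE (hg (t, nat_of_ord i)).
Qed.

(** Bounded summation always includes the term at the bound; subtracting that term allows empty
    sums. *)
Lemma definable_sum (b : T -> nat) (G : T -> nat -> nat) :
  definable FF (extend_code c) (fun p => G p.1 p.2) -> D b ->
  D (fun t => \sum_(i < b t) G t i)%N.
Proof.
move=> DG Db; have Dl := definable_bind DG Db.
apply: eq_definable (definable_subn (definable_sumS DG Db) Dl) => t.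
by rewrite big_ord_recr /= addnK.
Qed.

(** The constant term [phi t] is summed [psi t] times. *)
Lemma definable_muln (phi psi : T -> nat) :
  D phi -> D psi -> D (fun t => (phi t * psi t)%N).
Proof.
move=> Dphi Dpsi; have Dw := definable_weaken Dphi.
apply: eq_definable (@definable_sum psi (fun t _ => phi t) Dw Dpsi) => t.
by rewrite sum_nat_const card_ord mulnC.
Qed.

(** Addition is not an initial function; it is recovered from x + y = (x + 1)(y + 1) - xy - 1. *)
Lemma definable_addn (phi psi : T -> nat) :
  D phi -> D psi -> D (fun t => (phi t + psi t)%N).
Proof.
move=> Dphi Dpsi.
have D1 := definable_muln (definable_succ Dphi) (definable_succ Dpsi).
have D2 := definable_subn D1 (definable_muln Dphi Dpsi).
apply: eq_definable (definable_subn D2 (definable_const 1)) => t.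
by rewrite mulSn mulnS; lia.
Qed.

(** The truth value is [1 - (phi t - psi t)] with truncated subtraction. *)
Lemma definable_leq (phi psi : T -> nat) :
  D phi -> D psi -> D (fun t => (phi t <= psi t)%N : nat).
Proof.
move=> Dphi Dpsi.
apply: eq_definable
  (definable_subn (definable_const 1) (definable_subn Dphi Dpsi)) => t.
by case: leqP; lia.
Qed.

Lemma definable_ltn (phi psi : T -> nat) :
  D phi -> D psi -> D (fun t => (phi t < psi t)%N : nat).
Proof. by move=> Dphi; apply: definable_leq; exact: definable_succ. Qed.
End Code.

Section Arithmetic.
Variables (T : Type) (n : nat) (c : T -> n.-tuple nat).
Local Notation D := (definable FF c).

Lemma definable_divn (phi psi : T -> nat) :
  D phi -> D psi -> D (fun t => (phi t %/ psi t)%N).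
Proof.
move=> Dphi Dpsi.
apply: (@eq_definable _ _ _ (fun t => (0 < psi t)%N *
    \sum_(i < phi t) (i.+1 * psi t <= phi t)%N)%N).
  by move=> t; rewrite -divn_sum.
apply: definable_muln; first exact: (definable_ltn (definable_const _ 0)).
apply: (@definable_sum _ _ _ _ (fun t i => (i.+1 * psi t <= phi t)%N : nat)) => //.
apply: definable_leq; last exact: definable_weaken.
by apply: definable_muln; [apply: definable_succ; exact: definable_last | exact: definable_weaken].
Qed.

Lemma definable_modn (phi psi : T -> nat) :
  D phi -> D psi -> D (fun t => (phi t %% psi t)%N).
Proof.
move=> Dphi Dpsi.
have D1 := definable_muln (definable_divn Dphi Dpsi) Dpsi.
apply: eq_definable (definable_subn Dphi D1) => t.
by rewrite {1}(divn_eq (phi t) (psi t)) addKn.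
Qed.

(** The exponent is fixed, so the induction takes place outside the class; a variable exponent could
    leave it. *)
Lemma definable_expn (phi : T -> nat) (k : nat) :
  D phi -> D (fun t => (phi t ^ k)%N).
Proof.
move=> Dphi; elim: k => [|k IH]; first exact: definable_const.
by apply: eq_definable (definable_muln Dphi IH) => t; rewrite expnS.
Qed.
End Arithmetic.

Lemma definable_dvdn (T : Type) (n : nat) (c : T -> n.-tuple nat) (phi psi : T -> nat) :
  definable FF c phi -> definable FF c psi ->
  definable FF c (fun t => (phi t %| psi t)%N : nat).
Proof.
move=> Dphi Dpsi.
apply: eq_definable (definable_leq
  (definable_modn Dpsi Dphi) (definable_const c 0)) => t.
by rewrite leqn0.
Qed.

Lemma definable_gcdn (T : Type) (n : nat) (c : T -> n.-tuple nat) (phi psi : T -> nat) :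
  (forall t, (0 < psi t)%N) -> definable FF c phi -> definable FF c psi ->
  definable FF c (fun t => gcdn (phi t) (psi t)).
Proof.
move=> psi0 Dphi Dpsi.
apply: (@eq_definable _ _ _ _ _ (fun t => esym (gcdn_sum _ (psi0 t)))).
apply: (@definable_sum _ _ _ _ (fun t i => (0 < \sum_(j < psi t)
  (i <= j) * ((j.+1 %| phi t) * (j.+1 %| psi t)))%N : nat)) => //.
apply: (definable_ltn (definable_const _ 0)).
have Dphi1 := definable_weaken Dphi.
have Dpsi1 := definable_weaken Dpsi.
apply: (@definable_sum _ _ _ _ (fun (p : T * nat) (j : nat) =>
  ((p.2 <= j)%N * ((j.+1 %| phi p.1) * (j.+1 %| psi p.1)))%N)) => //.
have Dj := definable_last (extend_code c).
have Di := definable_weaken (definable_last c).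
apply: definable_muln; first exact: definable_leq.
apply: definable_muln; apply: definable_dvdn; try exact: definable_succ.
  exact: definable_weaken Dphi1.
exact: definable_weaken Dpsi1.
Qed.

(** * Rational arithmetic on codes *)

Section Rationals.
Variables (T : Type) (n : nat) (c : T -> n.-tuple nat).
Local Notation D := (definable FF c).
Local Notation DQ := (definable_rat FF c).

Lemma eq_definable_rat (r s : T -> rat) : r =1 s -> DQ r -> DQ s.
Proof. by move=> /funext->. Qed.

(** The normal form to which the rational functions constructed below are brought: [code_frac]
    reduces it by means of a gcd and quotients. *)
Lemma definable_frac (p q m : T -> nat) : (forall t, (0 < m t)%N) ->
  D p -> D q -> D m -> DQ (fun t => ((p t)%:R - (q t)%:R) / (m t)%:R).
Proof.
move=> m0 Dp Dq Dm.
have Dpq := definable_subn Dp Dq.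
have Dqp := definable_subn Dq Dp.
have code t := code_frac (m0 t) (erefl (((p t)%:R - (q t)%:R) / (m t)%:R)).
split.
- apply: (@eq_definable _ _ _ (fun t => (p t - q t) %/ gcdn (p t - q t) (m t))%N).
    by move=> t; have [] := code t.
  by apply: definable_divn => //; exact: definable_gcdn.
- apply: (@eq_definable _ _ _ (fun t => (q t - p t) %/ gcdn (q t - p t) (m t))%N).
    by move=> t; have [] := code t.
  by apply: definable_divn => //; exact: definable_gcdn.
- apply: (@eq_definable _ _ _
    (fun t => (m t %/ gcdn ((p t - q t) + (q t - p t)) (m t)))%N).
    by move=> t; have [] := code t.
  apply: definable_divn => //; apply: definable_gcdn => //.
  exact: definable_addn.
Qed.

Lemma definable_ratD (r s : T -> rat) : DQ r -> DQ s -> DQ (fun t => r t + s t).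
Proof.
move=> [rp rn rd] [sp sn sd].
apply: (@eq_definable_rat (fun t =>
  ((code_pos (r t) * code_den (s t) + code_pos (s t) * code_den (r t))%N%:R -
   (code_neg (r t) * code_den (s t) + code_neg (s t) * code_den (r t))%N%:R) /
  (code_den (r t) * code_den (s t))%N%:R)).
  move=> t; rewrite [in RHS](rat_codeE (r t)) [in RHS](rat_codeE (s t)).
  have r0 : (code_den (r t))%:R != 0 :> rat by rewrite pnatr_eq0 -lt0n code_den_gt0.
  have s0 : (code_den (s t))%:R != 0 :> rat by rewrite pnatr_eq0 -lt0n code_den_gt0.
  by rewrite !natrD !natrM; field; rewrite s0 r0.
apply: definable_frac; last exact: definable_muln.
- by move=> t; rewrite muln_gt0 !code_den_gt0.
- by apply: definable_addn; exact: definable_muln.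
- by apply: definable_addn; exact: definable_muln.
Qed.

Lemma definable_ratN (r : T -> rat) : DQ r -> DQ (fun t => - r t).
Proof.
move=> [rp rn rd]; split.
- by apply: eq_definable rn => t; have [] := code_opp (r t).
- by apply: eq_definable rp => t; have [] := code_opp (r t).
- by apply: eq_definable rd => t; have [] := code_opp (r t).
Qed.

(** After cross-multiplication the negative parts change sides, which leaves a comparison of natural
    numbers. *)
Lemma definable_rat_le (r s : T -> rat) : DQ r -> DQ s -> D (fun t => (r t <= s t)%R : nat).
Proof.
move=> [rp rn rd] [sp sn sd].
apply: (@eq_definable _ _ _ (fun t =>
  (code_pos (r t) * code_den (s t) + code_neg (s t) * code_den (r t) <=
   code_pos (s t) * code_den (r t) + code_neg (r t) * code_den (s t))%N : nat)).
  move=> t; congr (nat_of_bool _); rewrite [in RHS](rat_codeE (r t)) [in RHS](rat_codeE (s t)).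
  have r0 : 0 < (code_den (r t))%:R :> rat by rewrite ltr0n code_den_gt0.
  have s0 : 0 < (code_den (s t))%:R :> rat by rewrite ltr0n code_den_gt0.
  rewrite ler_pdivrMr // mulrAC ler_pdivlMr //.
  rewrite -(ler_nat rat) !natrD !natrM.
  by apply/idP/idP; lra.
by apply: definable_leq; apply: definable_addn; exact: definable_muln.
Qed.

(** The layout of [code_args]: each coordinate occupies three consecutive places, so [i %/ 3] is the
    coordinate and [i %% 3] the component of its code. *)
Lemma nth_allpairs3 (x0 : nat) (s : seq rat) (i : nat) : (i < size s * 3)%N ->
  nth x0 (allpairs (fun r k => k r) s [:: code_pos; code_neg; code_den]) i =
  nth code_pos [:: code_pos; code_neg; code_den] (i %% 3) (nth 0 s (i %/ 3)).
Proof.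
elim: s i => // r s IH [|[|[|i]]] //= hi.
rewrite IH; last by rewrite /= mulSn in hi; lia.
have -> : (i.+3 %/ 3 = (i %/ 3).+1)%N by lia.
by have -> : (i.+3 %% 3 = i %% 3)%N by lia.
Qed.

Lemma tnth_code_args (N : nat) (a : 'rV[rat]_N) (e : nat) (i : 'I_(N * 3)) :
  exists j : 'I_N, tnth (code_args a e) (widen_ord (leqnSn _) i) =
    nth code_pos [:: code_pos; code_neg; code_den] (i %% 3) (a ord0 j) /\ j = (i %/ 3)%N :> nat.
Proof.
have ij : (i %/ 3 < N)%N by rewrite ltn_divLR.
exists (Ordinal ij); split=> //.
rewrite tnth_rcons_widen (tnth_nth 0%N) /= nth_allpairs3; last first.
  by rewrite size_map size_tuple card_ord.
by congr (nth _ _ _ _); exact: (nth_mktuple (a ord0) 0 (Ordinal ij)).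
Qed.

Lemma definable_coded (N : nat) (u : 'rV[rat]_N -> nat -> nat)
    (A : T -> 'rV[rat]_N) (E : T -> nat) :
  coded_in FF u -> (forall j, DQ (fun t => A t ord0 j)) -> D E ->
  D (fun t => u (A t) (E t)).
Proof.
move=> [g Fg hg] DA DE; pose s t := (A t, E t).
apply: (@definable_subst _ _ _ _ _ (fun p => code_args p.1 p.2)
  (fun p => u p.1 p.2) s).
  by exists g.
move=> i; case: (ord_max_or_widen i) => [->|[k ->]].
  by apply: eq_definable DE => t; rewrite tnth_rcons_max.
have kN : (k %/ 3 < N)%N by rewrite ltn_divLR.
apply: (@eq_definable _ _ _ (fun t => nth code_pos [:: code_pos; code_neg; code_den]
  (k %% 3) (A t ord0 (Ordinal kN)))).
  move=> t; have [j [-> jE]] := tnth_code_args (A t) (E t) k.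
  by have -> : j = Ordinal kN by apply: val_inj.
have [Dp Dn Dd] := DA (Ordinal kN).
by have := ltn_pmod k (isT : (0 < 3)%N); case: (k %% 3)%N => [|[|[|]]].
Qed.

Lemma definable_rat_fun (N : nat) (f : 'rV[rat]_N -> nat -> rat)
    (A : T -> 'rV[rat]_N) (E : T -> nat) :
  rat_fun_in FF f -> (forall j, DQ (fun t => A t ord0 j)) -> D E ->
  DQ (fun t => f (A t) (E t)).
Proof.
move=> [fp fn fd] DA DE; split.
- exact: (@definable_coded _ (fun a e => code_pos (f a e))).
- exact: (@definable_coded _ (fun a e => code_neg (f a e))).
- exact: (@definable_coded _ (fun a e => code_den (f a e))).
Qed.
End Rationals.

Lemma definable_rat_weaken (T : Type) (n : nat) (c : T -> n.-tuple nat) (r : T -> rat) :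
  definable_rat FF c r -> definable_rat FF (extend_code c) (fun p => r p.1).
Proof. by move=> [rp rn rd]; split; apply: (@definable_weaken _ _ _ (fun t => _ (r t))). Qed.

Definition code_point {N : nat} (p : 'rV[rat]_N * nat) := code_args p.1 p.2.

Lemma definable_coord (N : nat) (j : 'I_N) :
  definable_rat FF (@code_point N) (fun p => p.1 ord0 j).
Proof.
have H l : (l < 3)%N -> definable FF (@code_point N) (fun p =>
    nth code_pos [:: code_pos; code_neg; code_den] l (p.1 ord0 j)).
  move=> l3; have lt : (j * 3 + l < N * 3)%N by have := ltn_ord j; lia.
  apply: eq_definable (definable_tnth (@code_point N) (widen_ord (leqnSn _) (Ordinal lt))) => p.
  have [k [-> kE]] := tnth_code_args p.1 p.2 (Ordinal lt).
  rewrite /= modnMDl modn_small //.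
  have -> // : k = j.
  by apply: val_inj; rewrite [LHS]kE /= divnMDl // divn_small // addn0.
by split; [apply: (H 0%N)|apply: (H 1%N)|apply: (H 2%N)].
Qed.

Lemma definable_precision (N : nat) :
  definable FF (@code_point N) snd.
Proof.
by apply: eq_definable (definable_tnth (@code_point N) ord_max) => p; rewrite tnth_rcons_max.
Qed.

Lemma definable_coded_in (N : nat) (u : 'rV[rat]_N -> nat -> nat) :
  definable FF (@code_point N) (fun p => u p.1 p.2) -> coded_in FF u.
Proof. by move=> [g Fg hg]; exists g => // a e; rewrite (hg (a, e)). Qed.

Lemma definable_rat_fun_in (N : nat) (f : 'rV[rat]_N -> nat -> rat) :
  definable_rat FF (@code_point N) (fun p => f p.1 p.2) -> rat_fun_in FF f.
Proof. by move=> [fp fn fd]; split; apply: definable_coded_in. Qed.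

Definition code_nat (e : nat) : 1.-tuple nat := [tuple e].

Lemma definable_id : definable FF code_nat id.
Proof. by exists (fun t => tnth t ord0); first exact: good_proj. Qed.

Lemma definable_nat_fun_in (d : nat -> nat) : definable FF code_nat d -> nat_fun_in FF d.
Proof.
move=> [g Fg hg]; rewrite /nat_fun_in.
have -> // : (fun t : 1.-tuple nat => d (tnth t ord0)) = g.
apply/funext => t; rewrite hg; congr g.
by apply: eq_from_tnth => i; rewrite [i]ord1.
Qed.
End Definability.

(** * Integrals of step functions *)

Section StepFunctions.
Variable R : realType.
Local Notation mu := (@lebesgue_measure R).
Implicit Types (a b : R) (A : set R).

Lemma lebesgue_measure_oo a b : a <= b -> mu `]a, b[ = (b - a)%:E.
Proof.
move=> ab; rewrite lebesgue_measure_itv /= lte_fin.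
by case: ltgtP ab => // -> _; rewrite subrr.
Qed.

Lemma lebesgue_measure_co a b : a <= b -> mu `[a, b[ = (b - a)%:E.
Proof.
move=> ab; rewrite lebesgue_measure_itv /= lte_fin.
by case: ltgtP ab => // -> _; rewrite subrr.
Qed.

Lemma lebesgue_measure_oo_lty a b : (mu `]a, b[ < +oo)%E.
Proof. by rewrite lebesgue_measure_itv /=; case: ifP => // _; rewrite -EFinB ltry. Qed.

Lemma integrable_indic_oo a b A : measurable A ->
  mu.-integrable `]a, b[ (EFin \o (\1_A : R -> R)).
Proof.
move=> mA; apply: measurable_bounded_integrable => //.
- exact: lebesgue_measure_oo_lty.
- exists 1; split => // x x1 y _ /=; rewrite (le_trans _ (ltW x1)) //.
  by rewrite indicE; case: (_ \in _); rewrite ?normr1 ?normr0.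
Qed.

Lemma Rintegral_indic_oo a b A : measurable A ->
  \int[mu]_(y in `]a, b[) (\1_A y : R) = fine (mu (A `&` `]a, b[)).
Proof. by move=> mA; rewrite /Rintegral integral_indic. Qed.

Lemma integrable_scaled_indic_oo a b A (k : R) : measurable A ->
  mu.-integrable `]a, b[ (EFin \o (fun y => k * \1_A y)).
Proof.
move=> mA; apply: (@eq_integrable _ _ _ mu _ _ (fun y => k%:E * (\1_A y)%:E)%E) => //.
by apply: integrableZl => //; exact: integrable_indic_oo.
Qed.

Lemma integrable_sum_indic_oo a b (n : nat) (c : nat -> R) (A : nat -> set R) :
  (forall k, measurable (A k)) ->
  mu.-integrable `]a, b[ (EFin \o (fun y => \sum_(k < n) c k * \1_(A k) y)).
Proof.
move=> mA; elim: n => [|n IH].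
  apply: (@eq_integrable _ _ _ mu _ _ (cst 0%E)) => //; last exact: integrable0.
  by move=> y _ /=; rewrite big_ord0.
apply: (@eq_integrable _ _ _ mu _ _ ((EFin \o (fun y => \sum_(k < n) c k * \1_(A k) y)) \+
   (EFin \o (fun y => c n * \1_(A n) y)))) => //.
  by move=> y _ /=; rewrite big_ord_recr.
by apply: integrableD => //; exact: integrable_scaled_indic_oo.
Qed.

Lemma Rintegral_sum_indic_oo a b (n : nat) (c : nat -> R) (A : nat -> set R) :
  (forall k, measurable (A k)) ->
  \int[mu]_(y in `]a, b[) (\sum_(k < n) c k * \1_(A k) y) =
  \sum_(k < n) c k * fine (mu (A k `&` `]a, b[)).
Proof.
move=> mA; elim: n => [|n IH].
  rewrite big_ord0; under eq_Rintegral do rewrite big_ord0.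
  by rewrite Rintegral_cst // mul0r.
rewrite big_ord_recr -IH -Rintegral_indic_oo // -RintegralZl //; last first.
  exact: integrable_indic_oo.
under eq_Rintegral do rewrite big_ord_recr.
by rewrite RintegralD //; [exact: integrable_sum_indic_oo|exact: integrable_scaled_indic_oo].
Qed.

Lemma fine_measure_setI_le a b A (d : R) : measurable A -> (mu A <= d%:E)%E ->
  fine (mu (A `&` `]a, b[)) <= d.
Proof.
move=> mA Ad; have AI : (mu (A `&` `]a, b[) <= d%:E)%E.
  apply: le_trans Ad; apply: le_measure => //; rewrite ?inE //.
  exact: measurableI.
rewrite -lee_fin fineK // ge0_fin_numE //.
by apply: le_lt_trans AI _; rewrite ltry.
Qed.

(** Cells with a nonzero value lie inside the interval, so the sum is exactly the integral of a step
    function. That function is within [eta] of [f], except on zero cells near the two ends, where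
    [f] itself is the error: at most [K] on each of two pieces of length [delta]. *)
Lemma step_function_approx a b (f : R -> R) (n : nat) (c : nat -> R)
    (y0 w eta delta K : R) :
  a < b -> 0 < w -> 0 <= delta -> 0 <= K -> 0 <= eta ->
  mu.-integrable `]a, b[ (EFin \o f) ->
  (forall k, (k < n)%N -> c k = 0 \/
     `[y0 + k%:R * w, y0 + k.+1%:R * w[ `<=` `]a, b[) ->
  (forall y, a < y < b -> exists2 k, (k < n)%N &
     y0 + k%:R * w <= y < y0 + k.+1%:R * w /\
     (`|f y - c k| <= eta \/
      [/\ c k = 0, `|f y| <= K & y < a + delta \/ b - delta < y])) ->
  `|\int[mu]_(y in `]a, b[) f y - \sum_(k < n) c k * w| <=
    eta * (b - a) + (K * delta + K * delta).
Proof.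
move=> ab w0 d0 K0 eta0 fI csub capprox.
pose cell (k : nat) : set R := (`[y0 + k%:R * w, y0 + k.+1%:R * w[)%classic.
have mcell k : measurable (cell k) by exact: measurable_itv.
pose phi y := \sum_(k < n) c k * \1_(cell k) y.
have cellE k : mu (cell k) = w%:E.
  by rewrite lebesgue_measure_co; [congr (_%:E)|]; rewrite -natr1; lra.
have phiint : \sum_(k < n) c k * w = \int[mu]_(y in `]a, b[) phi y.
  rewrite Rintegral_sum_indic_oo //; apply: eq_bigr => k _.
  have [->|sub] := csub k (ltn_ord k); first by rewrite !mul0r.
  by rewrite (setIidl sub) cellE.
have phiI : mu.-integrable `]a, b[ (EFin \o phi) by exact: integrable_sum_indic_oo.
rewrite phiint -RintegralB //.
have fphiI : mu.-integrable `]a, b[ (EFin \o (fun y => f y - phi y)).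
  apply: (@eq_integrable _ _ _ mu _ _ ((EFin \o f) \- (EFin \o phi))%E) => //.
  exact: integrableB.
apply: (le_trans (le_normr_Rintegral _ fphiI)) => //.
pose A1 : set R := `]a, a + delta[%classic; pose A2 : set R := `]b - delta, b[%classic.
have mA1 : measurable A1 by exact: measurable_itv.
have mA2 : measurable A2 by exact: measurable_itv.
(* The error is dominated by [eta] plus [K] times the indicators of the two end pieces, written as a
   sum of three weighted indicators so that the formula for its integral applies. *)
pose kk (i : nat) := nth 0 [:: eta; K; K] i.
pose AA (i : nat) := nth setT [:: setT; A1; A2] i.
have mAA i : measurable (AA i) by rewrite /AA; case: i => [|[|[|i]]] //=; rewrite ?nth_nil.
have psiI := integrable_sum_indic_oo a b 3 kk mAA.
apply: (@le_trans _ _ (\int[mu]_(y in `]a, b[) (\sum_(i < 3) kk i * \1_(AA i) y))).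
  apply: le_Rintegral => //.
    have := integrable_norm fphiI => //.
  move=> y; rewrite /= in_itv /= => yab.
  have [k kn [yk yapp]] := capprox y yab.
  have -> : phi y = c k.
    rewrite /phi (bigD1 (Ordinal kn)) //= big1 ?addr0 => [|j jk].
      by rewrite indicE mem_set ?mulr1 //= in_itv.
    (* The cells are half open: if [y] lay in cells [j] and [k], then [j < k.+1] and [k < j.+1],
       which forces [j = k]. *)
    rewrite indicE memNset ?mulr0 // /cell /= in_itv /= => /andP[yj1 yj2].
    move/eqP: jk; apply; apply: val_inj => /=; move: (nat_of_ord j) yj1 yj2 => {}j yj1 yj2.
    have h1 : (j%:R : R) < k.+1%:R by rewrite -(ltr_pM2r w0); lra.
    have h2 : (k%:R : R) < j.+1%:R by rewrite -(ltr_pM2r w0); lra.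
    move: h1 h2; rewrite !ltr_nat !ltnS => jk kj.
    by apply/eqP; rewrite eqn_leq jk.
  rewrite !big_ord_recl big_ord0 /kk /AA /= indicT mulr1 addr0.
  have i1 A : 0 <= K * \1_A y by rewrite mulr_ge0 // indicE ler0n.
  case: yapp => [|[-> fK ydelta]].
    by move=> /le_trans -> //; rewrite lerDl addr_ge0.
  rewrite subr0; apply: le_trans fK _.
  case: ydelta => yd.
    have -> : \1_A1 y = 1 :> R.
      by rewrite indicE mem_set // /A1 /= in_itv /= yd; case/andP: yab => ->.
    by rewrite mulr1; have := i1 A2; lra.
  have -> : \1_A2 y = 1 :> R.
    by rewrite indicE mem_set // /A2 /= in_itv /= yd; case/andP: yab => _ ->.
  by rewrite mulr1; have := i1 A1; lra.
rewrite Rintegral_sum_indic_oo // !big_ord_recl big_ord0 /kk /AA /= addr0.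
rewrite setTI (lebesgue_measure_oo (ltW ab)) /= lerD2l.
(* The end pieces may stick out of the interval when [delta] is large; intersecting with it only
   decreases their measure. *)
by apply: lerD; rewrite ler_wpM2l //; apply: fine_measure_setI_le => //;
  rewrite lebesgue_measure_oo; rewrite ?lee_fin; lra.
Qed.
End StepFunctions.

(** * The exhaustion of the region between two graphs *)

(** Each induction step adds a leading digit, which contributes a multiple of [M ^ j.+1] for every
    lower place [j] and so leaves the earlier digits unchanged. *)
Lemma digits_exist (M N : nat) (k : nat -> nat) : (forall j, (k j < M)%N) ->
  exists2 i, (i < M ^ N)%N & forall j, (j < N)%N -> ((i %/ M ^ j) %% M = k j)%N.
Proof.
move=> kM; have M0 : (0 < M)%N by apply: leq_ltn_trans (kM 0%N).
elim: N => [|N [i iM IH]]; first by exists 0%N.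
exists (k N * M ^ N + i)%N => [|j].
  rewrite expnS (@leq_trans (k N * M ^ N + M ^ N)) ?ltn_add2l //.
  by rewrite -mulSnr leq_mul2r kM orbT.
rewrite ltnS leq_eqVlt => /predU1P[->|jN].
  by rewrite divnMDl ?expn_gt0 ?M0 // divn_small // addn0 modn_small.
have -> : (M ^ N = M ^ (N - j.+1) * M * M ^ j)%N.
  by rewrite -expnSr -expnD addSnnS subnK.
by rewrite mulnA divnMDl ?expn_gt0 ?M0 // mulnA modnMDl IH.
Qed.

Section Geometry.
Variable R : realType.

Lemma le_inv_nat (m n : nat) : (0 < m)%N -> (m <= n)%N ->
  (n%:R^-1 : R) <= m%:R^-1.
Proof.
move=> m0 mn; rewrite lef_pV2 ?ler_nat // posrE ltr0n //.
exact: leq_trans mn.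
Qed.

Lemma inv_nat_gt0 (m : nat) : (0 < m)%N -> (0 : R) < m%:R^-1.
Proof. by move=> m0; rewrite invr_gt0 ltr0n. Qed.

Lemma exists_inv_nat_lt (d : R) : 0 < d -> exists2 m, (0 < m)%N & m%:R^-1 < d.
Proof.
move=> d0; exists (Num.truncn d^-1).+1 => //.
by rewrite invf_plt ?posrE ?ltr0n // truncnS_gt.
Qed.

Lemma row_coord_le (N : nat) (x : 'rV[R]_N) (j : 'I_N) : `|x ord0 j| <= `|x|.
Proof.
rewrite [leRHS]mx_normrE.
exact: (le_bigmax _ (fun ij : 'I_1 * 'I_N => `|x ij.1 ij.2|) (ord0, j)).
Qed.

Lemma row_norm_lt (N : nat) (x : 'rV[R]_N) (d : R) :
  0 < d -> (forall j, `|x ord0 j| < d) -> `|x| < d.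
Proof.
move=> d0 xd; rewrite [ltLHS]mx_normrE.
by apply: bigmax_lt => // -[i j] _ /=; rewrite ord1.
Qed.

Lemma row_norm_le (N : nat) (x : 'rV[R]_N) (d : R) :
  0 <= d -> (forall j, `|x ord0 j| <= d) -> `|x| <= d.
Proof.
move=> d0 xd; rewrite [leLHS]mx_normrE.
by apply: bigmax_le => // -[i j] _ /=; rewrite ord1.
Qed.

Lemma exists_rat_row (N : nat) (x : 'rV[R]_N) (d : R) : 0 < d ->
  exists a : 'rV[rat]_N, `|x - map_mx ratr a| < d.
Proof.
move=> d0.
have /choice[q qx] : forall j : 'I_N, exists q : rat, `|x ord0 j - ratr q| < d.
  move=> j; have [|q] := @rat_in_itvoo R (x ord0 j - d) (x ord0 j + d); first lra.
  by rewrite in_itv /= => /andP[? ?]; exists q; rewrite ltr_norml; lra.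
by exists (\row_j q j); apply: row_norm_lt => // j; rewrite !mxE.
Qed.

(** The distance condition says that the open ball of radius 1/e around [x] lies in [O]; this form
    also covers an empty complement, where the distance is infinite. *)
Lemma exhaustP (N : nat) (O : set 'rV[R]_N) (e : nat) (x : 'rV[R]_N) : (0 < e)%N ->
  exhaust O e x <->
  `|x| <= e%:R /\ forall x', `|x - x'| < e%:R^-1 -> O x'.
Proof.
move=> e0; have ei0 := inv_nat_gt0 e0; split.
  move=> [Ox xe xd]; split=> // x' xx'; apply: contrapT => nOx'.
  (* A radius strictly between the norm and 1/e: membership in an open ball bounds the distance only
     by the radius of the ball. *)
  pose r := (`|x - x'| + e%:R^-1) / 2.
  have r0 : 0 < r by have := normr_ge0 (x - x'); rewrite /r; lra.
  have rx : `|x - x'| < r by rewrite /r; lra.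
  have re : r < e%:R^-1 by rewrite /r; lra.
  have : (e%:R^-1%:E <= r%:E)%E.
    apply: le_trans xd _; apply: (@le_trans _ _ (edist (x, x'))).
      by apply: ereal_inf_lbound; exists x'.
    by apply: edist_fin => //=; rewrite -ball_normE.
  by rewrite lee_fin; lra.
move=> [xe xO]; split=> //; first by apply: xO; rewrite subrr normr0.
apply: le_ereal_inf_tmp => _ [x' nOx' <-]; rewrite leNgt; apply/negP.
by move=> /edist_lt_ball /=; rewrite -ball_normE => /xO.
Qed.

Lemma exhaust_le (N : nat) (O : set 'rV[R]_N) (e m : nat) (x : 'rV[R]_N) :
  (0 < e)%N -> (e <= m)%N -> exhaust O e x -> exhaust O m x.
Proof.
move=> e0 em /(exhaustP _ _ e0)[xe xO].
apply/exhaustP; first exact: leq_trans em.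
split=> [|x' xx']; first by rewrite (le_trans xe) // ler_nat.
by apply: xO; apply: lt_le_trans xx' _; exact: le_inv_nat.
Qed.

(** A move by less than 1/(2e) leaves a ball of radius 1/(2e) in [O] and keeps the norm below e + 1
    <= 2e. *)
Lemma exhaust_near (N : nat) (O : set 'rV[R]_N) (e m : nat) (x x' : 'rV[R]_N) :
  (0 < e)%N -> (2 * e <= m)%N -> exhaust O e x -> `|x - x'| < m%:R^-1 ->
  exhaust O m x'.
Proof.
move=> e0 em /(exhaustP _ _ e0)[xe xO] xx'.
have e20 : (0 < 2 * e)%N by rewrite muln_gt0.
have {}xx' : `|x - x'| < (2 * e)%N%:R^-1.
  by apply: lt_le_trans xx' _; exact: le_inv_nat.
apply: exhaust_le em _ => //; apply/exhaustP => //.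
have e1 : 1 <= e%:R :> R by rewrite ler1n.
have i2 : (2 * e)%N%:R^-1 = 2^-1 * e%:R^-1 :> R by rewrite natrM invfM.
have ie : e%:R^-1 <= 1 :> R by rewrite invf_le1 // (lt_le_trans ltr01).
split=> [|x'' x'x''].
  have := ler_normB x (x - x'); rewrite subKr natrM; lra.
apply: xO; have := ler_distD x' x x''; lra.
Qed.

Lemma open_exhaust (N : nat) (O : set 'rV[R]_N) (x : 'rV[R]_N) :
  open O -> O x -> exists2 e, (0 < e)%N & exhaust O e x.
Proof.
rewrite openE => oO /oO /nbhs_ballP[r /= r0 rO].
have [m m0 mr] := exists_inv_nat_lt r0.
pose e := (m + (Num.truncn `|x|).+1)%N.
exists e; first by rewrite /e addnS.
apply/exhaustP; first by rewrite /e addnS.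
split.
  rewrite (le_trans (ltW (truncnS_gt _))) // ler_nat leq_addl //.
move=> x' xx'; apply: rO; rewrite -ball_normE /=.
apply: lt_trans mr; apply: lt_le_trans xx' _; apply: le_inv_nat => //.
exact: leq_addr.
Qed.

Lemma snoc_row (N : nat) (z : 'rV[R]_(N + 1)) : exists x y, z = snoc x y.
Proof.
exists (lsubmx z), (rsubmx z ord0 ord0); rewrite /snoc -{1}(hsubmxK z).
by congr row_mx; apply/matrixP => i j; rewrite !ord1 !mxE.
Qed.

Lemma snoc_l (N : nat) (x : 'rV[R]_N) (y : R) (j : 'I_N) :
  snoc x y ord0 (lshift 1 j) = x ord0 j.
Proof. exact: row_mxEl. Qed.

Lemma snoc_r (N : nat) (x : 'rV[R]_N) (y : R) (j : 'I_1) :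
  snoc x y ord0 (rshift N j) = y.
Proof. by rewrite /snoc row_mxEr mxE. Qed.

Lemma norm_snoc_lt (N : nat) (x : 'rV[R]_N) (y d : R) :
  `|x| < d -> `|y| < d -> `|snoc x y| < d.
Proof.
move=> xd yd; apply: row_norm_lt => [|j]; first exact: le_lt_trans yd.
by case: (split_ordP j) => k ->; rewrite ?snoc_l ?snoc_r // (le_lt_trans (row_coord_le _ _)).
Qed.

Lemma norm_snoc_le (N : nat) (x : 'rV[R]_N) (y d : R) :
  `|x| <= d -> `|y| <= d -> `|snoc x y| <= d.
Proof.
move=> xd yd; apply: row_norm_le => [|j]; first exact: le_trans yd.
by case: (split_ordP j) => k ->; rewrite ?snoc_l ?snoc_r // (le_trans (row_coord_le _ _)).
Qed.

Lemma norm_init_le (N : nat) (x : 'rV[R]_N) (y : R) : `|x| <= `|snoc x y|.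
Proof.
apply: row_norm_le => // j; rewrite -(snoc_l x y); exact: row_coord_le.
Qed.

Lemma norm_last_le (N : nat) (x : 'rV[R]_N) (y : R) : `|y| <= `|snoc x y|.
Proof. by rewrite -{1}(snoc_r x y ord0); exact: row_coord_le. Qed.

Lemma snocB (N : nat) (x x' : 'rV[R]_N) (y y' : R) :
  snoc x y - snoc x' y' = snoc (x - x') (y - y').
Proof.
by rewrite /snoc opp_row_mx add_row_mx; congr row_mx; apply/matrixP => i j; rewrite !mxE.
Qed.

Definition snoc_rat (N : nat) (a : 'rV[rat]_N) (q : rat) : 'rV[rat]_(N + 1) :=
  row_mx a (const_mx q).

Lemma map_snoc_rat (N : nat) (a : 'rV[rat]_N) (q : rat) :
  map_mx ratr (snoc_rat a q) = snoc (map_mx ratr a) (ratr q) :> 'rV[R]_(N + 1).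
Proof. by rewrite /snoc_rat map_row_mx map_const_mx. Qed.

(** The analytic half of [real_fun_in], for given witnesses and without their membership in the
    class. *)
Definition approximates (N : nat) (O : set 'rV[R]_N) (F : 'rV[R]_N -> R)
    (d : nat -> nat) (f : 'rV[rat]_N -> nat -> rat) : Prop :=
  (forall e, (0 < e)%N -> (0 < d e)%N) /\
  forall (e : nat) (a : 'rV[rat]_N) (x : 'rV[R]_N),
    (0 < e)%N -> exhaust O e x -> `|x - map_mx ratr a| < (d e)%:R^-1 ->
    `|F x - ratr (f a e)| < e%:R^-1.

(** * Rational approximation near a point and the strip between the graphs *)

Section Strip.
Variables (N : nat) (O : set 'rV[R]_N) (G H : 'rV[R]_N -> R).
Variables (dG dH : nat -> nat) (fG fH : 'rV[rat]_N -> nat -> rat).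
Hypotheses (aG : approximates O G dG fG) (aH : approximates O H dH fH).

(** One value [f a m] serves a whole neighbourhood of [x]: the factor 2 splits the modulus between
    the distances from [x] to [a] and from [x] to [x']. *)
Lemma approximates_near (K : 'rV[R]_N -> R) d f (e m : nat) (x x' : 'rV[R]_N)
    (a : 'rV[rat]_N) :
  approximates O K d f -> (0 < e)%N -> (2 * e <= m)%N -> exhaust O e x ->
  `|x - map_mx ratr a| < (2 * d m)%:R^-1 ->
  `|x - x'| < m%:R^-1 -> `|x - x'| < (2 * d m)%:R^-1 ->
  `|K x' - ratr (f a m)| < m%:R^-1.
Proof.
move=> [d0 aK] e0 em xe xa xx'm xx'd.
have m0 : (0 < m)%N by apply: leq_trans em; rewrite muln_gt0.
apply: (aK _ _ _ m0 (exhaust_near e0 em xe xx'm)).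
have i2 : (2 * d m)%:R^-1 = 2^-1 * (d m)%:R^-1 :> R by rewrite natrM invfM.
rewrite i2 in xa xx'd.
rewrite distrC in xx'd.
have := ler_distD x x' (map_mx ratr a); lra.
Qed.

(** Of the margin 2/m, one half absorbs the error of [fG a m] or [fH a m] at every nearby [x'], the
    other the passage from [y] to [y'], since 1/e' <= 1/m. Hence the ball of radius 1/e' around the
    point stays between the graphs. *)
Lemma exhaust_between (e m e' : nat) (x : 'rV[R]_N) (a : 'rV[rat]_N) (y : R) :
  (0 < e)%N -> (2 * e <= m)%N -> exhaust O e x ->
  `|x - map_mx ratr a| < (2 * dG m)%:R^-1 ->
  `|x - map_mx ratr a| < (2 * dH m)%:R^-1 ->
  (m <= e')%N -> (2 * dG m <= e')%N -> (2 * dH m <= e')%N ->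
  `|y| <= e'%:R ->
  ratr (fG a m) + 2 * m%:R^-1 <= y -> y <= ratr (fH a m) - 2 * m%:R^-1 ->
  exhaust (between O G H) e' (snoc x y).
Proof.
move=> e0 em xe xG xH me' Ge' He' ye' Gy yH.
have m0 : (0 < m)%N by apply: leq_trans em; rewrite muln_gt0.
have e'0 : (0 < e')%N by apply: leq_trans me'.
have me : (e <= m)%N by apply: leq_trans em; rewrite leq_pmull.
have dG0 : (0 < dG m)%N by case: aG => + _; apply.
have dH0 : (0 < dH m)%N by case: aH => + _; apply.
have [xe1 _] := (exhaustP O x e0).1 xe.
apply/exhaustP => //; split.
  apply: norm_snoc_le => //; by rewrite (le_trans xe1) // ler_nat (leq_trans me).
move=> z; have [x' [y' ->]] := snoc_row z; rewrite snocB => zz'.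
have xx' : `|x - x'| < e'%:R^-1 by exact: le_lt_trans (norm_init_le _ _) zz'.
have yy' : `|y - y'| < e'%:R^-1 by exact: le_lt_trans (norm_last_le _ _) zz'.
have ie' : e'%:R^-1 <= m%:R^-1 :> R by exact: le_inv_nat.
have xx'm : `|x - x'| < m%:R^-1 by exact: lt_le_trans xx' ie'.
have xx'G : `|x - x'| < (2 * dG m)%:R^-1.
  by apply: lt_le_trans xx' _; apply: le_inv_nat => //; rewrite muln_gt0.
have xx'H : `|x - x'| < (2 * dH m)%:R^-1.
  by apply: lt_le_trans xx' _; apply: le_inv_nat => //; rewrite muln_gt0.
have := approximates_near aG e0 em xe xG xx'm xx'G.
have := approximates_near aH e0 em xe xH xx'm xx'H.
rewrite !ltr_norml => /andP[h1 h2] /andP[g1 g2].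
move: yy'; rewrite ltr_norml => /andP[y1 y2].
exists x', y'; split => //; last by lra.
by have [] := exhaust_near e0 em xe xx'm.
Qed.

Variables (F : 'rV[R]_(N + 1) -> R) (dF : nat -> nat)
  (fF : 'rV[rat]_(N + 1) -> nat -> rat).
Hypothesis aF : approximates (between O G H) F dF fF.

(** Continuity comes from approximability: at each precision a single rational value [fF b e'] is
    close to [F] on a whole neighbourhood of the point. *)
Lemma slice_continuous (x : 'rV[R]_N) : open O -> O x ->
  {in `]G x, H x[, continuous (fun y => F (snoc x y))}.
Proof.
move=> oO Ox y; rewrite in_itv /= => /andP[Gy yH].
have [e e0 xe] := open_exhaust oO Ox.
(* The distance to each graph must exceed 4/m: 2/m for the margin, 1/m for the approximation of the
   graph, 1/m for moving [y]. *)
have [m1 m10 m1G] := @exists_inv_nat_lt ((y - G x) / 4) ltac:(lra).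
have [m2 m20 m2H] := @exists_inv_nat_lt ((H x - y) / 4) ltac:(lra).
pose m := (2 * e + m1 + m2)%N.
have m0 : (0 < m)%N by rewrite /m; move: m10; clear; lia.
have em : (2 * e <= m)%N by rewrite /m; clear; lia.
have mG : m%:R^-1 <= m1%:R^-1 :> R.
  by apply: le_inv_nat => //; rewrite /m; clear; lia.
have mH : m%:R^-1 <= m2%:R^-1 :> R.
  by apply: le_inv_nat => //; rewrite /m; clear; lia.
have dG0 : (0 < dG m)%N by case: aG => + _; apply.
have dH0 : (0 < dH m)%N by case: aH => + _; apply.
have dd0 : (0 < 2 * dG m + 2 * dH m)%N by move: dG0; clear; lia.
have [a xa] := exists_rat_row x (inv_nat_gt0 dd0).
have xG : `|x - map_mx ratr a| < (2 * dG m)%:R^-1.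
  apply: lt_le_trans xa _; apply: le_inv_nat; last exact: leq_addr.
  by rewrite muln_gt0.
have xH : `|x - map_mx ratr a| < (2 * dH m)%:R^-1.
  apply: lt_le_trans xa _; apply: le_inv_nat; last exact: leq_addl.
  by rewrite muln_gt0.
have im0 := inv_nat_gt0 m0.
have := approximates_near aG e0 em xe xG (x' := x).
rewrite subrr normr0 => /(_ im0 (inv_nat_gt0 _)).
rewrite muln_gt0 dG0 => /(_ isT); rewrite ltr_norml => /andP[g1 g2].
have := approximates_near aH e0 em xe xH (x' := x).
rewrite subrr normr0 => /(_ im0 (inv_nat_gt0 _)).
rewrite muln_gt0 dH0 => /(_ isT); rewrite ltr_norml => /andP[h1 h2].
apply/cvgrPdist_lt => eps eps0.
have [k k0 keps] := @exists_inv_nat_lt (eps / 2) ltac:(lra).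
(* The first three terms are required by [exhaust_between], the fourth bounds every [y'] within
   distance 1 of [y], and [k] makes 1/e' smaller than eps/2. *)
pose e' := (m + 2 * dG m + 2 * dH m + (Num.truncn (`|y| + 1)).+1 + k)%N.
have e'm : (m <= e')%N by rewrite /e'; clear; lia.
have e'G : (2 * dG m <= e')%N by rewrite /e'; clear; lia.
have e'H : (2 * dH m <= e')%N by rewrite /e'; clear; lia.
have e'y : ((Num.truncn (`|y| + 1)).+1 <= e')%N by rewrite /e'; clear; lia.
have e'0 : (0 < e')%N by exact: leq_trans e'm.
have e'k : e'%:R^-1 <= k%:R^-1 :> R by apply: le_inv_nat => //; rewrite /e' leq_addl.
have d0 : (0 < dF e')%N by case: aF => + _; apply.
have id0 := inv_nat_gt0 d0.
have [b xb] := @exists_rat_row _ (snoc x y) ((dF e')%:R^-1 / 2) ltac:(lra).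
have im1 : m%:R^-1 <= 1 :> R by rewrite invf_le1 ?ler1n // ltr0n.
have near_F y' : `|y - y'| < m%:R^-1 -> `|y - y'| < (dF e')%:R^-1 / 2 ->
    `|F (snoc x y') - ratr (fF b e')| < e'%:R^-1.
  move=> yy'm yy'd; apply: (proj2 aF _ _ _ e'0).
    move: (yy'm); rewrite ltr_norml => /andP[y1 y2].
    apply: (exhaust_between e0 em xe xG xH e'm e'G e'H); [|lra|lra].
    apply: (@le_trans _ _ (Num.truncn (`|y| + 1)).+1%:R); last by rewrite ler_nat.
    apply: le_trans (ltW (truncnS_gt _)); have := ler_normB y (y - y').
    by rewrite subKr; lra.
  apply: (@le_lt_trans _ _ (`|snoc x y' - snoc x y| + `|snoc x y - map_mx ratr b|)).
    exact: ler_distD.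
  have : `|snoc x y' - snoc x y| < (dF e')%:R^-1 / 2.
    by rewrite snocB subrr norm_snoc_lt // ?normr0 1?distrC //; lra.
  lra.
have Fy : `|F (snoc x y) - ratr (fF b e')| < e'%:R^-1.
  by apply: near_F; rewrite subrr normr0 //; lra.
near=> y'.
have {}near_F : `|F (snoc x y') - ratr (fF b e')| < e'%:R^-1.
  apply: near_F; near: y'.
    by apply: cvgr_dist_lt => //; exact: cvg_id.
  by apply: cvgr_dist_lt; [exact: cvg_id|lra].
rewrite distrC in near_F.
have := ler_distD (ratr (fF b e')) (F (snoc x y)) (F (snoc x y')); lra.
Unshelve. all: by end_near.
Qed.

End Strip.
End Geometry.

(** * Riemann sums *)

Lemma nat_cell (R : realType) (z : R) (M k : nat) : (0 < M)%N -> 0 <= z ->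
  k = Num.truncn (z * M%:R) -> k%:R * M%:R^-1 <= z < k%:R * M%:R^-1 + M%:R^-1.
Proof.
move=> M0 z0 ->; have M0' : 0 < M%:R :> R by rewrite ltr0n.
rewrite -[X in _ + X]mul1r -mulrDl natr1 ler_pdivrMr // ltr_pdivlMr // truncnS_gt andbT truncn_le //.
by rewrite mulr_ge0 // ltW.
Qed.

(** * Bounds in the class for functions on the exhaustion *)

Section Bounds.
Variables (R : realType) (FF : fun_class) (N : nat).
Hypothesis hFF : good FF.

(* The points of the grid are numbered by the base [grid_size d e] expansions of
   their coordinates, so that one bounded sum runs over all of them. *)
Definition grid_size (d e : nat) : nat := (2 * e * d.+1).+1.

Definition grid_point (d e i : nat) : 'rV[rat]_N :=
  \row_j ((((i %/ grid_size d e ^ j) %% grid_size d e)%N%:R - (e * d.+1)%N%:R)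
            / d.+1%:R).

(** Each coordinate is rounded down to a multiple of 1/(d + 1). The denominator [d.+1] is positive
    for every [d], as definability of the grid demands, whereas a modulus is known to be positive
    only at positive arguments. *)
Lemma grid_point_near (d e : nat) (x : 'rV[R]_N) : (0 < d)%N -> `|x| <= e%:R ->
  exists2 i, (i < grid_size d e ^ N)%N &
    `|x - map_mx ratr (grid_point d e i)| < d%:R^-1.
Proof.
move=> d0 xe; set M := grid_size d e.
have xj (j : 'I_N) : 0 <= x ord0 j + e%:R <= 2 * e%:R.
  by have := le_trans (row_coord_le x j) xe; rewrite ler_norml => /andP[]; lra.
(* [insub] extends the digits by 0 beyond the coordinates, since [digits_exist] takes a function on
   all natural numbers. *)
pose k (j : nat) : nat :=
  if insub j is Some j' then Num.truncn ((x ord0 j' + e%:R) * d.+1%:R) else 0%N.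
have kM j : (k j < M)%N.
  rewrite /k; case: insubP => // j' _ _; rewrite ltnS -(ler_nat R).
  have /andP[x0 x1] := xj j'.
  apply: (@le_trans _ _ ((x ord0 j' + e%:R) * d.+1%:R)).
    by rewrite truncn_le // mulr_ge0.
  by rewrite !natrM ler_pM2r.
have [i iM iE] := digits_exist N kM.
exists i => //; apply: row_norm_lt => [|j]; first exact: inv_nat_gt0.
rewrite !mxE iE // /k [insub _](valK j).
rewrite fmorph_div rmorphB /= !ratr_nat.
have /andP[x0 _] := xj j.
have /andP[c1 c2] := nat_cell (ltn0Sn d) x0 erefl.
apply: (@lt_le_trans _ _ d.+1%:R^-1); last exact: le_inv_nat.
have d10 : d.+1%:R != 0 :> R by rewrite pnatr_eq0.
rewrite natrM mulrBl mulfK //.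
move: c1 c2; set u : R := _ / _; set v : R := _^-1; move: u v => u v c1 c2.
rewrite ger0_norm; lra.
Qed.

(** A sum over the grid replaces a maximum. Since [N] is fixed, the number of grid points is a fixed
    power and stays in the class; the final successor covers the approximation error 1/e <= 1. *)
Lemma real_fun_bounded (O : set 'rV[R]_N) (G : 'rV[R]_N -> R) d f :
  approximates O G d f -> nat_fun_in FF d -> rat_fun_in FF f ->
  exists2 B, nat_fun_in FF B &
    forall e x, (0 < e)%N -> exhaust O e x -> `|G x| <= (B e)%:R.
Proof.
move=> [d0 aG] Fd Ff.
pose val e i := (code_pos (f (grid_point (d e) e i) e) +
                 code_neg (f (grid_point (d e) e i) e))%N.
exists (fun e => (\sum_(i < grid_size (d e) e ^ N) val e i).+1).
  apply: definable_nat_fun_in; apply: definable_succ => //.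
  have Did : definable FF code_nat id by exact: definable_id.
  have Dd := definable_nat_fun hFF Fd Did.
  have Dsz : definable FF code_nat (fun e => grid_size (d e) e).
    apply: definable_succ => //; apply: definable_muln => //; last exact: definable_succ.
    by apply: definable_muln => //; exact: definable_const.
  apply: definable_sum => //; last exact: definable_expn.
  have De := definable_weaken hFF Did.
  have Dd1 := definable_weaken hFF Dd.
  have Dsz1 := definable_weaken hFF Dsz.
  have [fp fn fd] : definable_rat FF (extend_code code_nat)
      (fun p => f (grid_point (d p.1) p.1 p.2) p.1).
    apply: (@definable_rat_fun _ hFF _ _ _ _ _ (fun p => grid_point (d p.1) p.1 p.2) fst) => //.
    move=> j; apply: (@eq_definable_rat _ _ _ _ (fun p : nat * nat =>
      (((p.2 %/ grid_size (d p.1) p.1 ^ j) %% grid_size (d p.1) p.1)%N%:R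
        - (p.1 * (d p.1).+1)%N%:R) / (d p.1).+1%:R)).
      by move=> p; rewrite mxE.
    apply: definable_frac => //; last exact: definable_succ.
      apply: definable_modn => //; apply: definable_divn => //.
        exact: definable_last.
      exact: definable_expn.
    by apply: definable_muln => //; exact: definable_succ.
  exact: definable_addn.
move=> e x e0 xe; have [xe1 _] := (exhaustP O x e0).1 xe.
have [i iM xi] := grid_point_near (d0 _ e0) xe1.
have Gx := aG _ _ _ e0 xe xi.
set q := f _ e in Gx.
have e1 : e%:R^-1 <= 1 :> R by rewrite invf_le1 ?ler1n // ltr0n.
have qB : `|ratr q| <= (val e i)%:R :> R.
  by rewrite -ratr_norm -(ratr_nat R) ler_rat norm_le_code.
have vS : (val e i)%:R <= (\sum_(i < grid_size (d e) e ^ N) val e i)%N%:R :> R.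
  by rewrite ler_nat (bigD1 (Ordinal iM)) //= leq_addr.
rewrite -natr1.
have := ler_distD (ratr q) (G x) 0; rewrite !subr0; lra.
Qed.
End Bounds.

(** Positive and negative parts are both rounded down, with errors in [0, 1/L); these are
    subtracted, so the total stays within 1/L. *)
Lemma trunc_code (R : realType) (r : rat) (L : nat) : (0 < L)%N ->
  `|ratr r - (((code_pos r * L) %/ code_den r)%N%:R
              - ((code_neg r * L) %/ code_den r)%N%:R) / L%:R| <= (L%:R^-1 : R).
Proof.
move=> L0; have L0' : 0 < L%:R :> R by rewrite ltr0n.
have d0 : 0 < (code_den r)%:R :> R by rewrite ltr0n code_den_gt0.
have divE (x : nat) :
    (x %/ code_den r)%N%:R <= (x%:R / (code_den r)%:R : R) < (x %/ code_den r)%N%:R + 1.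
  rewrite ler_pdivlMr // ltr_pdivrMr // natr1 -!natrM ler_nat ltr_nat.
  by rewrite leq_divM -ltn_divLR ?code_den_gt0 ?ltnSn.
have rE : ratr r = (((code_pos r * L)%N%:R / (code_den r)%:R) -
    ((code_neg r * L)%N%:R / (code_den r)%:R)) / L%:R :> R.
  rewrite {1}(rat_codeE r) fmorph_div rmorphB /= !ratr_nat !natrM.
  by field; rewrite !gt_eqF.
have iL : 0 <= L%:R^-1 :> R by rewrite invr_ge0.
rewrite rE -mulrBl normrM [`|_^-1|]ger0_norm // ler_piMl //.
have /andP[p1 p2] := divE (code_pos r * L)%N.
have /andP[n1 n2] := divE (code_neg r * L)%N.
by rewrite ler_norml; lra.
Qed.

(** * The Riemann sum, its definability and its error *)

Section RiemannSum.
Variables (R : realType) (FF : fun_class) (hFF : good FF).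
Variables (N : nat) (O : set 'rV[R]_N) (hO : open O) (G H : 'rV[R]_N -> R).
Hypothesis hGH : forall x, O x -> G x < H x.
Variables (dG dH dF B : nat -> nat) (fG fH : 'rV[rat]_N -> nat -> rat).
Variable F : 'rV[R]_(N + 1) -> R.
Variable fF : 'rV[rat]_(N + 1) -> nat -> rat.
Hypotheses (aG : approximates O G dG fG) (aH : approximates O H dH fH).
Hypothesis aF : approximates (between O G H) F dF fF.
Hypotheses (FdG : nat_fun_in FF dG) (FdH : nat_fun_in FF dH).
Hypotheses (FdF : nat_fun_in FF dF) (FB : nat_fun_in FF B).
Hypotheses (FfG : rat_fun_in FF fG) (FfH : rat_fun_in FF fH).
Hypothesis FfF : rat_fun_in FF fF.
Hypothesis B_gt0 : forall e, (0 < B e)%N.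
Hypothesis GB : forall e x, (0 < e)%N -> exhaust O e x -> `|G x| <= (B e)%:R.
Hypothesis HB : forall e x, (0 < e)%N -> exhaust O e x -> `|H x| <= (B e)%:R.
Hypothesis FBd : forall e x y, (0 < e)%N -> exhaust O e x ->
  between O G H (snoc x y) -> `|F (snoc x y)| <= (B e)%:R.

(* The Riemann sum turns out to have error at most [12 * B e / strip_prec e]. *)
Definition strip_prec (e : nat) : nat := (13 * B e * e).+1.

(** Large enough for [exhaust_between] at every [y] with norm at most [B e]; it is also the
    denominator to which values are truncated. *)
Definition value_prec (e : nat) : nat :=
  (strip_prec e + 2 * dG (strip_prec e) + 2 * dH (strip_prec e) + B e)%N.

(** The cell width is at most [1 / strip_prec e] and at most the modulus of [F], so one node serves
    its whole cell. *)
Definition mesh (e : nat) : nat := (strip_prec e + dF (value_prec e))%N.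

Definition sum_modulus (e : nat) : nat :=
  (2 * dG (strip_prec e) + 2 * dH (strip_prec e) + dF (value_prec e))%N.

Definition node (e k : nat) : rat := (k%:R - (B e * mesh e)%N%:R) / (mesh e)%:R.

(** This is 2/m, written as a difference over a denominator to match [definable_frac]. *)
Definition margin (e : nat) : rat := (2%:R - 0%:R) / (strip_prec e)%:R.

Definition inner_cell (a : 'rV[rat]_N) (e k : nat) : bool :=
  (fG a (strip_prec e) + margin e <= node e k) &&
  (node e k.+1 <= fH a (strip_prec e) - margin e).

Definition cell_value (a : 'rV[rat]_N) (e k : nat) : rat :=
  fF (snoc_rat a (node e k)) (value_prec e).

(** The [2 * B e * mesh e] cells cover [-B e, B e). With values truncated to a common denominator,
    the positive and negative parts are plain bounded sums of natural numbers. *)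
Definition pos_sum (a : 'rV[rat]_N) (e : nat) : nat :=
  (\sum_(k < 2 * B e * mesh e) inner_cell a e k *
    ((code_pos (cell_value a e k) * value_prec e) %/ code_den (cell_value a e k)))%N.

Definition neg_sum (a : 'rV[rat]_N) (e : nat) : nat :=
  (\sum_(k < 2 * B e * mesh e) inner_cell a e k *
    ((code_neg (cell_value a e k) * value_prec e) %/ code_den (cell_value a e k)))%N.

Definition riemann_sum (a : 'rV[rat]_N) (e : nat) : rat :=
  ((pos_sum a e)%:R - (neg_sum a e)%:R) / (value_prec e * mesh e)%N%:R.

Lemma value_prec_gt0 e : (0 < value_prec e)%N.
Proof. by rewrite /value_prec /strip_prec !addSn. Qed.

Lemma mesh_gt0 e : (0 < mesh e)%N.
Proof. by rewrite /mesh /strip_prec addSn. Qed.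

Lemma definable_strip_prec : definable FF code_nat strip_prec.
Proof.
have Did := definable_id hFF; apply: definable_succ => //.
apply: definable_muln => //; apply: definable_muln => //; last exact: definable_nat_fun.
exact: definable_const.
Qed.

Lemma definable_double_at (d : nat -> nat) : nat_fun_in FF d ->
  definable FF code_nat (fun e => 2 * d (strip_prec e))%N.
Proof.
move=> Fd; apply: definable_muln => //; first exact: definable_const.
exact: (definable_nat_fun hFF Fd definable_strip_prec).
Qed.

Lemma definable_value_prec : definable FF code_nat value_prec.
Proof.
apply: definable_addn => //; last by apply: definable_nat_fun => //; exact: definable_id.
apply: definable_addn => //; last exact: definable_double_at.
apply: definable_addn => //; last exact: definable_double_at.
exact: definable_strip_prec.
Qed.

Lemma definable_mesh : definable FF code_nat mesh.
Proof.
apply: definable_addn => //; first exact: definable_strip_prec.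
exact: (definable_nat_fun hFF FdF definable_value_prec).
Qed.

Lemma sum_modulus_in : nat_fun_in FF sum_modulus.
Proof.
apply: definable_nat_fun_in; apply: definable_addn => //; last first.
  exact: (definable_nat_fun hFF FdF definable_value_prec).
by apply: definable_addn => //; exact: definable_double_at.
Qed.

Lemma riemann_sum_in : rat_fun_in FF riemann_sum.
Proof.
apply: definable_rat_fun_in.
have De : definable FF (@code_point N) snd by exact: definable_precision.
have DB := definable_nat_fun hFF FB De.
have Dm := definable_nat_fun hFF (definable_nat_fun_in definable_strip_prec) De.
have Dv := definable_nat_fun hFF (definable_nat_fun_in definable_value_prec) De.
have DM := definable_nat_fun hFF (definable_nat_fun_in definable_mesh) De.
(* The argument is [((a, e), k)]: rational point, precision, index of the cell. *)
pose c := extend_code (@code_point N).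
have De1 := definable_weaken hFF De.
have DB1 := definable_weaken hFF DB.
have Dm1 := definable_weaken hFF Dm.
have Dv1 := definable_weaken hFF Dv.
have DM1 := definable_weaken hFF DM.
have Dk : definable FF c snd by exact: definable_last.
have Dcoord j : definable_rat FF c (fun p => p.1.1 ord0 j).
  exact (definable_rat_weaken hFF (definable_coord hFF j)).
have Dnode (s : 'rV[rat]_N * nat * nat -> nat) : definable FF c s ->
    definable_rat FF c (fun p => node p.1.2 (s p)).
  move=> Ds; apply: definable_frac => //; exact: definable_muln.
have Dmargin : definable_rat FF c (fun p => margin p.1.2).
  by apply: definable_frac => //; exact: definable_const.
have DG1 : definable_rat FF c (fun p => fG p.1.1 (strip_prec p.1.2)).
  exact: definable_rat_fun.
have DH1 : definable_rat FF c (fun p => fH p.1.1 (strip_prec p.1.2)).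
  exact: definable_rat_fun.
have Dinner : definable FF c (fun p => inner_cell p.1.1 p.1.2 p.2 : nat).
  apply: (@eq_definable _ _ _ _ (fun p =>
    ((fG p.1.1 (strip_prec p.1.2) + margin p.1.2 <= node p.1.2 p.2)%R *
     (node p.1.2 p.2.+1 <= fH p.1.1 (strip_prec p.1.2) - margin p.1.2)%R)%N)).
    by move=> p; rewrite mulnb.
  apply: definable_muln => //.
    apply: definable_rat_le => //; last exact: Dnode.
    exact: definable_ratD.
  apply: definable_rat_le => //; first by apply: Dnode; exact: definable_succ.
  by apply: definable_ratD => //; exact: definable_ratN.
have [Dvp Dvn Dvd] : definable_rat FF c (fun p => cell_value p.1.1 p.1.2 p.2).
  apply: (@definable_rat_fun _ hFF _ _ _ _ _
    (fun p => snoc_rat p.1.1 (node p.1.2 p.2)) (fun p => value_prec p.1.2)) => // j.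
  case: (split_ordP j) => i ->.
    by apply: eq_definable_rat (Dcoord i) => p; rewrite /snoc_rat row_mxEl.
  by apply: eq_definable_rat (Dnode _ Dk) => p; rewrite /snoc_rat row_mxEr mxE.
have Dn : definable FF (@code_point N) (fun p => 2 * B p.2 * mesh p.2)%N.
  apply: definable_muln => //; apply: definable_muln => //.
  exact: definable_const.
apply: (definable_frac hFF).
- by move=> p; rewrite muln_gt0 value_prec_gt0 mesh_gt0.
- apply: (definable_sum hFF (G := fun (p : 'rV[rat]_N * nat) k => (inner_cell p.1 p.2 k *
    ((code_pos (cell_value p.1 p.2 k) * value_prec p.2) %/
      code_den (cell_value p.1 p.2 k)))%N)) => //.
  apply: definable_muln => //; apply: definable_divn => //.
  exact: definable_muln.
- apply: (definable_sum hFF (G := fun (p : 'rV[rat]_N * nat) k => (inner_cell p.1 p.2 k *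
    ((code_neg (cell_value p.1 p.2 k) * value_prec p.2) %/
      code_den (cell_value p.1 p.2 k)))%N)) => //.
  apply: definable_muln => //; apply: definable_divn => //.
  exact: definable_muln.
- exact: definable_muln.
Qed.

(** The slice is continuous, hence measurable, and it is bounded by [B e] on an interval of finite
    length, for any [e] with [x] in [O_e]. *)
Lemma slice_integrable (x : 'rV[R]_N) : O x ->
  (@lebesgue_measure R).-integrable `]G x, H x[ (fun y => (F (snoc x y))%:E).
Proof.
move=> Ox; have [e e0 xe] := open_exhaust hO Ox.
suff : (@lebesgue_measure R).-integrable `]G x, H x[ (EFin \o (fun y : R => F (snoc x y))) by [].
apply: measurable_bounded_integrable => //.
- exact: lebesgue_measure_oo_lty.
- apply: open_continuous_measurable_fun; first exact: interval_open.
  by move=> y; rewrite inE => /(slice_continuous aG aH aF hO Ox).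
- exists (B e)%:R; split => // b Bb y; rewrite /= in_itv /= => Gy.
  by rewrite (le_trans _ (ltW Bb)) // FBd //; exists x, y.
Qed.

Lemma ratr_node (e k : nat) :
  ratr (node e k) = - (B e)%:R + k%:R * (mesh e)%:R^-1 :> R.
Proof.
have M0 : (mesh e)%:R != 0 :> R by rewrite pnatr_eq0 -lt0n mesh_gt0.
by rewrite /node fmorph_div rmorphB /= !ratr_nat natrM mulrBl mulfK // addrC.
Qed.

Lemma ratr_margin (e : nat) : ratr (margin e) = 2 * (strip_prec e)%:R^-1 :> R.
Proof. by rewrite /margin fmorph_div rmorphB /= !ratr_nat subr0. Qed.

(** The height, on cell [k], of the step function whose integral is the Riemann sum. *)
Definition step_value (a : 'rV[rat]_N) (e k : nat) : R :=
  ((inner_cell a e k *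
    ((code_pos (cell_value a e k) * value_prec e) %/ code_den (cell_value a e k)))%N%:R
   - (inner_cell a e k *
    ((code_neg (cell_value a e k) * value_prec e) %/ code_den (cell_value a e k)))%N%:R)
  / (value_prec e)%:R.

Lemma ratr_riemann_sum (a : 'rV[rat]_N) (e : nat) :
  ratr (riemann_sum a e) =
  \sum_(k < 2 * B e * mesh e) step_value a e k * (mesh e)%:R^-1 :> R.
Proof.
rewrite /riemann_sum fmorph_div rmorphB /= !ratr_nat natrM invfM mulrA.
rewrite -mulr_suml; congr (_ * _); rewrite /step_value -mulr_suml; congr (_ * _).
by rewrite /pos_sum /neg_sum !natr_sum -sumrB.
Qed.

Lemma step_value_outer (a : 'rV[rat]_N) (e k : nat) :
  ~~ inner_cell a e k -> step_value a e k = 0.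
Proof. by move=> /negbTE h; rewrite /step_value h !mul0n subrr mul0r. Qed.

Lemma step_value_inner (a : 'rV[rat]_N) (e k : nat) : inner_cell a e k ->
  `|ratr (cell_value a e k) - step_value a e k| <= (value_prec e)%:R^-1.
Proof. by move=> h; rewrite /step_value h !mul1n; exact: trunc_code (value_prec_gt0 e). Qed.

(** * The error of the Riemann sum at one point *)

Section AtPoint.
Variables (e : nat) (a : 'rV[rat]_N) (x : 'rV[R]_N).
Hypotheses (e_gt0 : (0 < e)%N) (xe : exhaust O e x).
Hypothesis xa : `|x - map_mx ratr a| < (sum_modulus e)%:R^-1.

Local Notation m := (strip_prec e).
Local Notation im := (m%:R^-1 : R).
Local Notation M := (mesh e).
Local Notation v := (value_prec e).

Let dG0 : (0 < dG m)%N. Proof. by case: aG => + _; apply. Qed.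
Let dH0 : (0 < dH m)%N. Proof. by case: aH => + _; apply. Qed.
Let dF0 : (0 < dF v)%N.
Proof. by case: aF => + _; apply; exact: value_prec_gt0. Qed.

Let em : (2 * e <= m)%N.
Proof.
rewrite /strip_prec ltnW // ltnS leq_mul2r; apply/orP; right.
exact: leq_trans (leq_mul (leqnn 13) (B_gt0 e)).
Qed.

Let xG : `|x - map_mx ratr a| < (2 * dG m)%:R^-1.
Proof.
apply: lt_le_trans xa _; apply: le_inv_nat; first by rewrite muln_gt0.
by rewrite /sum_modulus -addnA leq_addr.
Qed.

Let xH : `|x - map_mx ratr a| < (2 * dH m)%:R^-1.
Proof.
apply: lt_le_trans xa _; apply: le_inv_nat; first by rewrite muln_gt0.
by rewrite /sum_modulus addnAC leq_addl.
Qed.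

Let xF : `|x - map_mx ratr a| < (dF v)%:R^-1.
Proof.
by apply: lt_le_trans xa _; apply: le_inv_nat => //; rewrite /sum_modulus leq_addl.
Qed.

Let im0 : 0 < im. Proof. exact: inv_nat_gt0. Qed.

Let Gnear : `|G x - ratr (fG a m)| < im.
Proof.
apply: (approximates_near aG e_gt0 em xe xG); rewrite subrr normr0 //.
by apply: inv_nat_gt0; rewrite muln_gt0.
Qed.

Let Hnear : `|H x - ratr (fH a m)| < im.
Proof.
apply: (approximates_near aH e_gt0 em xe xH); rewrite subrr normr0 //.
by apply: inv_nat_gt0; rewrite muln_gt0.
Qed.

Let mM : M%:R^-1 <= im.
Proof. by apply: le_inv_nat => //; rewrite /mesh leq_addr. Qed.

Let mv : v%:R^-1 <= im.
Proof. by apply: le_inv_nat => //; rewrite /value_prec -!addnA leq_addr. Qed.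

Let iM0 : 0 < M%:R^-1 :> R. Proof. exact: inv_nat_gt0 (mesh_gt0 e). Qed.

(** One 1/v is the error of [fF] at the node, the other the truncation of its value. *)
Lemma inner_cell_approx (k : nat) (y : R) : inner_cell a e k ->
  ratr (node e k) <= y < ratr (node e k) + M%:R^-1 -> `|y| <= (B e)%:R ->
  `|F (snoc x y) - step_value a e k| <= 2 * v%:R^-1.
Proof.
move=> inn /andP[y1 y2] yB; have := step_value_inner inn.
move/andP: (inn) => [i1 i2].
move: i1 i2; rewrite -!(ler_rat R) rmorphD rmorphB /= ratr_margin => i1 i2.
have n1 : ratr (node e k.+1) = ratr (node e k) + M%:R^-1 :> R.
  by rewrite !ratr_node -natr1 mulrDl mul1r addrA.
have Ue : exhaust (between O G H) v (snoc x y).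
  apply: (exhaust_between aG aH e_gt0 em xe xG xH); rewrite /value_prec.
  - by rewrite -!addnA leq_addr.
  - by rewrite -addnA addnAC leq_addl.
  - by rewrite addnAC leq_addl.
  - by rewrite (le_trans yB) // ler_nat leq_addl.
  - by lra.
  - by move: i2; rewrite n1; lra.
have := proj2 aF _ (snoc_rat a (node e k)) _ (value_prec_gt0 e) Ue.
rewrite map_snoc_rat snocB => /(_ (norm_snoc_lt xF _)).
have yd : `|y - ratr (node e k)| < (dF v)%:R^-1.
  rewrite ger0_norm; last by rewrite subr_ge0.
  apply: (@lt_le_trans _ _ M%:R^-1); first by lra.
  by apply: le_inv_nat => //; rewrite /mesh leq_addl.
move=> /(_ yd); rewrite -/(cell_value a e k).
have := ler_distD (ratr (cell_value a e k)) (F (snoc x y)) (step_value a e k).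
move: `|F _ - _| `|ratr _ - _| `|F _ - ratr _| => p q r; move: (_^-1) => s.
lra.
Qed.

Lemma inner_cell_sub (k : nat) : inner_cell a e k ->
  `[- (B e)%:R + k%:R * M%:R^-1, - (B e)%:R + k.+1%:R * M%:R^-1[ `<=` `]G x, H x[.
Proof.
move=> /andP[]; rewrite -!(ler_rat R).
rewrite rmorphD rmorphB /= ratr_margin !ratr_node => i1 i2 y /=.
rewrite !in_itv /= => /andP[y1 y2].
move: Gnear Hnear; rewrite !ltr_norml => /andP[g1 g2] /andP[h1 h2].
have i1' := le_trans i1 y1; have i2' := lt_le_trans y2 i2.
have := im0; lra.
Qed.

(** The constant 4 is 2 for the margin, 1 for the error of [fG] or [fH], and 1 for the width of the
    cell. *)
Lemma outer_cell_margin (k : nat) (y : R) : ~~ inner_cell a e k ->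
  ratr (node e k) <= y < ratr (node e k) + M%:R^-1 ->
  y < G x + 4 * im \/ H x - 4 * im < y.
Proof.
rewrite negb_and -!ltNge => out /andP[y1 y2].
have n1 : ratr (node e k.+1) = ratr (node e k) + M%:R^-1 :> R.
  by rewrite !ratr_node -natr1 mulrDl mul1r addrA.
move: Gnear Hnear; rewrite !ltr_norml => /andP[g1 g2] /andP[h1 h2].
have mM' : M%:R^-1 <= m%:R^-1 :> R by exact: mM.
case/orP: out; rewrite -(ltr_rat R) ?rmorphB ?rmorphD /= ?ratr_margin ?n1.
  by left; lra.
by right; lra.
Qed.

Lemma riemann_sum_error :
  `|\int[@lebesgue_measure R]_(y in `]G x, H x[) F (snoc x y) - ratr (riemann_sum a e)|
    < e%:R^-1.
Proof.
have Ox : O x by case: xe.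
have iv0 : 0 < v%:R^-1 :> R by exact: inv_nat_gt0 (value_prec_gt0 e).
have GBe := GB e_gt0 xe; have HBe := HB e_gt0 xe.
move: (GBe) (HBe); rewrite !ler_norml => /andP[G1 G2] /andP[H1 H2].
have B0 : 0 < (B e)%:R :> R by rewrite ltr0n.
rewrite ratr_riemann_sum.
have := @step_function_approx R (G x) (H x) (fun y => F (snoc x y))
  (2 * B e * M) (step_value a e) (- (B e)%:R) M%:R^-1 (2 * v%:R^-1) (4 * im) (B e)%:R
  (hGH Ox) iM0 _ (ltW B0) _ (slice_integrable Ox).
move=> /(_ _ _ _ _)/le_lt_trans; apply.
- by rewrite mulr_ge0 // ltW.
- by rewrite mulr_ge0 // ltW.
- move=> k _; have [inn|out] := boolP (inner_cell a e k).
    by right; exact: inner_cell_sub.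
  by left; exact: step_value_outer.
- move=> y /andP[Gy yH].
  have yB : `|y| <= (B e)%:R by rewrite ler_norml; lra.
  have y0 : 0 <= y + (B e)%:R by lra.
  (* The index of the cell containing [y]; it is in range because [y] lies strictly below [H x],
     hence below [B e]. *)
  pose k := Num.truncn ((y + (B e)%:R) * M%:R).
  have /andP[c1 c2] := nat_cell (mesh_gt0 e) y0 (erefl k).
  have ky : ratr (node e k) <= y < ratr (node e k) + M%:R^-1.
    by rewrite ratr_node; apply/andP; split; lra.
  exists k.
    rewrite truncn_lt_nat; last by rewrite mulr_ge0.
    rewrite 2!natrM ltr_pM2r ?ltr0n ?mesh_gt0 //; lra.
  split.
    by rewrite -natr1 mulrDl mul1r addrA -ratr_node.
  have [inn|out] := boolP (inner_cell a e k).
    by left; exact: inner_cell_approx.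
  right; split; first exact: step_value_outer.
    by apply: FBd e_gt0 xe _; exists x, y; rewrite Gy yH.
  exact: outer_cell_margin ky.
have e0' : 0 < e%:R :> R by rewrite ltr0n.
have mE : m%:R = 13 * (B e)%:R * e%:R + 1 :> R by rewrite /strip_prec -natr1 !natrM.
(* The strips contribute 8B/m, and the inner cells (2/v)(H x - G x) <= 4B/m, as H x - G x <= 2B and
   1/v <= 1/m. Since m = 13Be + 1, the total 12B/m is below 1/e. *)
have : 12 * (B e)%:R * im < e%:R^-1.
  rewrite -/(_ / _) ltr_pdivrMr ?ltr0n // [ltRHS]mulrC ltr_pdivlMr // mE; nra.
apply: le_lt_trans.
have HG := hGH Ox.
have : v%:R^-1 * (H x - G x) <= m%:R^-1 * (2 * (B e)%:R) :> R.
  by apply: ler_pM => //; lra.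
lra.
Qed.
End AtPoint.

Lemma integral_approximates :
  approximates O (fun x => \int[@lebesgue_measure R]_(y in `]G x, H x[) F (snoc x y))
    sum_modulus riemann_sum.
Proof.
split=> [e _|e a x e0 xe xa]; last exact: riemann_sum_error.
rewrite /sum_modulus addn_gt0; apply/orP; right.
by case: aF => + _; apply; exact: value_prec_gt0.
Qed.
End RiemannSum.

Unset Implicit Arguments.

Theorem theorem5p1 (R : realType) (FF : fun_class) (hFF : good FF)
    (N : nat) (O : set 'rV[R]_N) (hO : open O)
    (G H : 'rV[R]_N -> R)
    (hG : real_fun_in FF O G) (hH : real_fun_in FF O H)
    (hGH : forall x, O x -> G x < H x)
    (F : 'rV[R]_(N + 1) -> R) (hF : real_fun_in FF (between O G H) F)
    (hK : exists K : 'rV[R]_N -> R, real_fun_in FF O K /\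
      forall x y, between O G H (snoc x y) -> `|F (snoc x y)| <= K x) :
  (forall x, O x ->
    (@lebesgue_measure R).-integrable `]G x, H x[ (fun y => (F (snoc x y))%:E)) /\
  real_fun_in FF O
    (fun x => \int[@lebesgue_measure R]_(y in `]G x, H x[) F (snoc x y)).
Proof.
have [dG [fG [FdG FfG dG0 aG']]] := hG; have aG := conj dG0 aG'.
have [dH [fH [FdH FfH dH0 aH']]] := hH; have aH := conj dH0 aH'.
have [dF [fF [FdF FfF dF0 aF']]] := hF; have aF := conj dF0 aF'.
have [K [[dK [fK [FdK FfK dK0 aK']]] FK]] := hK; have aK := conj dK0 aK'.
have [BG FBG GB] := real_fun_bounded hFF aG FdG FfG.
have [BH FBH HB] := real_fun_bounded hFF aH FdH FfH.
have [BK FBK KB] := real_fun_bounded hFF aK FdK FfK.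
(* A common bound for [G], [H] and [K]; the successor makes it positive at every [e]. *)
pose B e := (BG e + BH e + BK e).+1.
have FB : nat_fun_in FF B.
  have Did := definable_id hFF.
  apply: definable_nat_fun_in; apply: definable_succ => //.
  apply: definable_addn => //; last exact: definable_nat_fun.
  by apply: definable_addn => //; exact: definable_nat_fun.
have B0 e : (0 < B e)%N by [].
have {}GB e x : (0 < e)%N -> exhaust O e x -> `|G x| <= (B e)%:R.
  move=> e0 xe; rewrite (le_trans (GB _ _ e0 xe)) // ler_nat ltnW // ltnS.
  by rewrite -addnA leq_addr.
have {}HB e x : (0 < e)%N -> exhaust O e x -> `|H x| <= (B e)%:R.
  move=> e0 xe; rewrite (le_trans (HB _ _ e0 xe)) // ler_nat ltnW // ltnS.
  by rewrite addnAC leq_addl.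
have FBd e x y : (0 < e)%N -> exhaust O e x ->
    between O G H (snoc x y) -> `|F (snoc x y)| <= (B e)%:R.
  move=> e0 xe /FK /le_trans -> //; apply: le_trans (ler_norm _) _.
  rewrite (le_trans (KB _ _ e0 xe)) // ler_nat ltnW // ltnS.
  by rewrite leq_addl.
split=> [x|]; first exact: (slice_integrable hO aG aH aF FBd).
have [s0 sa] := integral_approximates hO hGH aG aH aF B0 GB HB FBd.
exists (sum_modulus dG dH dF B), (riemann_sum dG dH dF B fG fH fF); split => //.
  exact: sum_modulus_in.
exact: riemann_sum_in.
Qed.
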